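(* There is an equivalence of categories $$T_{C^\infty\text{-ring}}\simeq C^\infty\text{-ring}\times_{\mathrm{CRing}}T_{\mathrm{CRing}},$$ where $T_{C^\infty\text{-ring}}$ and $T_{\mathrm{CRing}}$ are the tangent categories of the category of $C^\infty$-rings and of the category of commutative rings, and the pullback is formed along the underlying-commutative-ring functor $C^\infty\text{-ring}\to\mathrm{CRing}$ and the projection $T_{\mathrm{CRing}}\to\mathrm{CRing}$ sending an abelian group object over a ring $A$ to $A$.
   Context: Let $\mathbb{E}$ be the full subcategory of the category of smooth manifolds spanned by $\mathbb{R}^n$, $n\in\mathbb{Z}_{\ge 0}$. A $C^\infty$-ring is a product preserving functor $A:\mathbb{E}\to\mathrm{Set}$; $C^\infty\text{-ring}$ is the full subcategory of the functor category spanned by these. The underlying commutative ring of $A$ is the set $A(\mathbb{R})$ with operations $A(+),A(0),A(-),A(\cdot),A(1)$. $\mathrm{CRing}$ is the category of commutative rings with unit. Tangent category: let $\mathcal{C}$ be a category with finite pullbacks. For $A\in\mathrm{Ob}(\mathcal{C})$ let $\mathrm{Ab}(\mathcal{C}/A)$ be the category of abelian group objects in the slice category $\mathcal{C}/A$. An object of $T_{\mathcal{C}}$ is an object of $\mathrm{Ab}(\mathcal{C}/A)$ for some $A$. For $X\in\mathrm{Ab}(\mathcal{C}/A)$ and $Y\in\mathrm{Ab}(\mathcal{C}/B)$, a morphism $X\to Y$ is a pair $(f,\phi)$ with $f:A\to B$ an arrow in $\mathcal{C}$ and $\phi:X\to f^\ast Y$ an arrow in $\mathrm{Ab}(\mathcal{C}/A)$,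 where $f^\ast$ denotes pullback along $f$. The pullback of categories $\mathcal{A}\times_{\mathcal{C}}\mathcal{B}$ along functors $f:\mathcal{A}\to\mathcal{C}$, $g:\mathcal{B}\to\mathcal{C}$ is the subcategory of $\mathcal{A}\times\mathcal{B}$ containing exactly those objects and arrows $(x,y)$ for which $f(x)=g(y)$. *)

(* Defs.v *)
From HB Require Import structures.
From mathcomp Require Import all_boot all_order all_algebra.
From mathcomp Require Import boolp classical_sets reals topology normedtype derive.

Set Implicit Arguments.
Unset Strict Implicit.
Unset Printing Implicit Defensive.

Import GRing.Theory numFieldNormedType.Exports.

Declare Scope cat_scope.
Delimit Scope cat_scope with cat.
Local Open Scope cat_scope.

Record category := Category {
  obj :> Type;
  hom : obj -> obj -> Type;
  idc : forall a, hom a a;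
  compc : forall a b c, hom b c -> hom a b -> hom a c;
  compcA : forall a b c d (h : hom c d) (g : hom b c) (f : hom a b),
    compc h (compc g f) = compc (compc h g) f;
  comp1c : forall a b (f : hom a b), compc (idc b) f = f;
  compc1 : forall a b (f : hom a b), compc f (idc a) = f }.

Notation "g ∘ f" := (compc g f) (at level 40, left associativity) : cat_scope.

Record functor (C D : category) := Functor {
  fobj :> C -> D;
  fmap : forall a b : C, hom a b -> hom (fobj a) (fobj b);
  fmap_id : forall a, fmap (idc a) = idc (fobj a);
  fmap_comp : forall a b c (g : hom b c) (f : hom a b),
    fmap (g ∘ f) = fmap g ∘ fmap f }.

Definition functor_id (C : category) : functor C C :=
  @Functor C C (fun a => a) (fun a b f => f) (fun a => erefl)
    (fun a b c g f => erefl).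

Section FunctorComp.
Variables (C D E : category) (G : functor D E) (F : functor C D).

Lemma functor_comp_id (a : C) : fmap G (fmap F (idc a)) = idc (G (F a)).
Proof. by rewrite !fmap_id. Qed.

Lemma functor_comp_comp (a b c : C) (g : hom b c) (f : hom a b) :
  fmap G (fmap F (g ∘ f)) = fmap G (fmap F g) ∘ fmap G (fmap F f).
Proof. by rewrite !fmap_comp. Qed.

Definition functor_comp : functor C E :=
  @Functor C E (fun a => G (F a)) (fun a b f => fmap G (fmap F f))
    functor_comp_id functor_comp_comp.
End FunctorComp.

Record nattrans (C D : category) (F G : functor C D) := NatTrans {
  ntapp :> forall a : C, hom (F a) (G a);
  nt_natural : forall (a b : C) (f : hom a b),
    ntapp b ∘ fmap F f = fmap G f ∘ ntapp a }.

Lemma nattrans_ext (C D : category) (F G : functor C D) (s t : nattrans F G) :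
  (forall a, s a = t a) -> s = t.
Proof.
case: s t => [s Hs] [t Ht] /= st.
have e : s = t by apply: functional_extensionality_dep.
by case: _ / e Ht {st} => Ht; congr NatTrans; exact: Prop_irrelevance.
Qed.

Lemma sval_inj (T : Type) (P : T -> Prop) (x y : {t : T | P t}) :
  sval x = sval y -> x = y.
Proof.
case: x y => [x Px] [y Py] /= e; case: _ / e Py => Py.
by congr exist; exact: Prop_irrelevance.
Qed.

Definition is_iso (C : category) (a b : C) (f : hom a b) : Prop :=
  exists g : hom b a, g ∘ f = idc a /\ f ∘ g = idc b.

Definition naturally_isomorphic (C D : category) (F G : functor C D) : Prop :=
  exists s : nattrans F G, forall a, is_iso (s a).

Definition equivalent (C D : category) : Prop :=
  exists (F : functor C D) (G : functor D C),
    naturally_isomorphic (functor_comp G F) (functor_id C) /\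
    naturally_isomorphic (functor_comp F G) (functor_id D).

Section FunctorCategory.
Variables C D : category.

Lemma nt_id_natural (F : functor C D) (a b : C) (f : hom a b) :
  idc (F b) ∘ fmap F f = fmap F f ∘ idc (F a).
Proof. by rewrite comp1c compc1. Qed.

Definition nt_id (F : functor C D) : nattrans F F :=
  NatTrans (@nt_id_natural F).

Lemma nt_comp_natural (F G H : functor C D) (t : nattrans G H)
    (s : nattrans F G) (a b : C) (f : hom a b) :
  (t b ∘ s b) ∘ fmap F f = fmap H f ∘ (t a ∘ s a).
Proof. by rewrite -compcA nt_natural compcA nt_natural compcA. Qed.

Definition nt_comp (F G H : functor C D) (t : nattrans G H)
    (s : nattrans F G) : nattrans F H :=
  NatTrans (nt_comp_natural t s).

Lemma nt_compA (F G H K : functor C D) (u : nattrans H K) (t : nattrans G H)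
    (s : nattrans F G) : nt_comp u (nt_comp t s) = nt_comp (nt_comp u t) s.
Proof. by apply: nattrans_ext => a /=; rewrite compcA. Qed.

Lemma nt_comp1 (F G : functor C D) (s : nattrans F G) :
  nt_comp (nt_id G) s = s.
Proof. by apply: nattrans_ext => a /=; rewrite comp1c. Qed.

Lemma nt_1comp (F G : functor C D) (s : nattrans F G) :
  nt_comp s (nt_id F) = s.
Proof. by apply: nattrans_ext => a /=; rewrite compc1. Qed.

Definition functor_category : category :=
  @Category (functor C D) (@nattrans C D) nt_id nt_comp
    nt_compA nt_comp1 nt_1comp.
End FunctorCategory.

Definition full_subcategory (C : category) (P : C -> Prop) : category :=
  @Category {a : C | P a} (fun a b => hom (sval a) (sval b))
    (fun a => idc (sval a)) (fun a b c g f => g ∘ f)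
    (fun a b c d h g f => compcA h g f)
    (fun a b f => comp1c f) (fun a b f => compc1 f).

Definition set_category : category :=
  @Category Type (fun S T => S -> T) (fun S x => x) (fun S T U g f x => g (f x))
    (fun S T U V h g f => erefl) (fun S T f => erefl) (fun S T f => erefl).

Definition is_terminal (C : category) (a : C) : Prop :=
  forall t : C, exists! h : hom t a, True.

Definition is_product (C : category) (a b p : C)
    (p1 : hom p a) (p2 : hom p b) : Prop :=
  forall (t : C) (u : hom t a) (v : hom t b),
    exists! h : hom t p, p1 ∘ h = u /\ p2 ∘ h = v.

Definition product_preserving (C D : category) (F : functor C D) : Prop :=
  (forall a : C, is_terminal a -> is_terminal (F a)) /\
  (forall (a b p : C) (p1 : hom p a) (p2 : hom p b),
     is_product p1 p2 -> is_product (fmap F p1) (fmap F p2)).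

Record terminal_object (C : category) := TerminalObject {
  term :> C;
  bang : forall t : C, hom t term;
  bang_uniq : forall (t : C) (h k : hom t term), h = k }.

Record product (C : category) (a b : C) := Product {
  prod_obj :> C;
  pr1 : hom prod_obj a;
  pr2 : hom prod_obj b;
  pairc : forall t : C, hom t a -> hom t b -> hom t prod_obj;
  pr1_pairc : forall (t : C) (u : hom t a) (v : hom t b), pr1 ∘ pairc u v = u;
  pr2_pairc : forall (t : C) (u : hom t a) (v : hom t b), pr2 ∘ pairc u v = v;
  prod_uniq : forall (t : C) (h k : hom t prod_obj),
    pr1 ∘ h = pr1 ∘ k -> pr2 ∘ h = pr2 ∘ k -> h = k }.

Record finite_products (C : category) := FiniteProducts {
  fp_term : terminal_object C;
  fp_prod : forall a b : C, product a b }.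

Record pullback (C : category) (a b c : C) (f : hom a c) (g : hom b c) :=
  Pullback {
  pb_obj :> C;
  pb1 : hom pb_obj a;
  pb2 : hom pb_obj b;
  pb_comm : f ∘ pb1 = g ∘ pb2;
  pb_lift : forall (t : C) (u : hom t a) (v : hom t b),
    f ∘ u = g ∘ v -> hom t pb_obj;
  pb1_lift : forall (t : C) (u : hom t a) (v : hom t b) (e : f ∘ u = g ∘ v),
    pb1 ∘ pb_lift e = u;
  pb2_lift : forall (t : C) (u : hom t a) (v : hom t b) (e : f ∘ u = g ∘ v),
    pb2 ∘ pb_lift e = v;
  pb_uniq : forall (t : C) (h k : hom t pb_obj),
    pb1 ∘ h = pb1 ∘ k -> pb2 ∘ h = pb2 ∘ k -> h = k }.

Arguments pb_lift {C a b c f g} p {t u v} e.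

(* A choice of pullbacks, from which the functors f^* are computed. *)
Definition pullbacks (C : category) :=
  forall (a b c : C) (f : hom a c) (g : hom b c), pullback f g.

Lemma pb_lift_comp (C : category) (a b c : C) (f : hom a c) (g : hom b c)
    (P : pullback f g) (s t : C) (u : hom t a) (v : hom t b) (w : hom s t)
    (e : f ∘ u = g ∘ v) (e' : f ∘ (u ∘ w) = g ∘ (v ∘ w)) :
  pb_lift P e ∘ w = pb_lift P e'.
Proof. by apply: pb_uniq; rewrite compcA ?pb1_lift ?pb2_lift. Qed.

Lemma pb_lift_eq (C : category) (a b c : C) (f : hom a c) (g : hom b c)
    (P : pullback f g) (t : C) (u u' : hom t a) (v v' : hom t b)
    (e : f ∘ u = g ∘ v) (e' : f ∘ u' = g ∘ v') :
  u = u' -> v = v' -> pb_lift P e = pb_lift P e'.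
Proof. by move=> uu vv; apply: pb_uniq; rewrite ?pb1_lift ?pb2_lift. Qed.

(* Products in C/A are fibre products over A. *)
Section Slice.
Variables (C : category) (A : C).

Record slice_obj := SliceObj { src :> C; arr : hom src A }.

Definition slice_hom (X Y : slice_obj) := {h : hom X Y | arr Y ∘ h = arr X}.

Lemma slice_hom_ext (X Y : slice_obj) (h k : slice_hom X Y) :
  sval h = sval k -> h = k.
Proof. exact: sval_inj. Qed.

Definition slice_id (X : slice_obj) : slice_hom X X :=
  exist _ (idc (src X)) (compc1 (arr X)).

Lemma slice_comp_subproof (X Y Z : slice_obj) (g : slice_hom Y Z)
  (f : slice_hom X Y) : arr Z ∘ (sval g ∘ sval f) = arr X.
Proof. by rewrite compcA (svalP g) (svalP f). Qed.

Definition slice_comp (X Y Z : slice_obj) (g : slice_hom Y Z)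
    (f : slice_hom X Y) : slice_hom X Z :=
  exist _ (sval g ∘ sval f) (slice_comp_subproof g f).

Lemma slice_compA (X Y Z T : slice_obj) (h : slice_hom Z T)
    (g : slice_hom Y Z) (f : slice_hom X Y) :
  slice_comp h (slice_comp g f) = slice_comp (slice_comp h g) f.
Proof. by apply: slice_hom_ext; exact: compcA. Qed.

Lemma slice_comp1 (X Y : slice_obj) (f : slice_hom X Y) :
  slice_comp (slice_id Y) f = f.
Proof. by apply: slice_hom_ext; exact: comp1c. Qed.

Lemma slice_1comp (X Y : slice_obj) (f : slice_hom X Y) :
  slice_comp f (slice_id X) = f.
Proof. by apply: slice_hom_ext; exact: compc1. Qed.

Definition slice : category :=
  @Category slice_obj slice_hom slice_id slice_comp
    slice_compA slice_comp1 slice_1comp.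

Variable pb : pullbacks C.

Definition slice_term_obj : slice := SliceObj (idc A).

Definition slice_bang (X : slice) : hom X slice_term_obj :=
  exist (fun h : hom (src X) A => idc A ∘ h = arr X) (arr X) (comp1c (arr X)).

Lemma slice_bang_uniq (X : slice) (h k : hom X slice_term_obj) : h = k.
Proof.
by apply: slice_hom_ext; rewrite -[LHS]comp1c -[RHS]comp1c (svalP h) (svalP k).
Qed.

Definition slice_term : terminal_object slice :=
  TerminalObject slice_bang slice_bang_uniq.

Section SliceProduct.
Variables X Y : slice.

Let P := pb (arr X) (arr Y).

Definition slice_prod_obj : slice := SliceObj (arr X ∘ pb1 P).

Definition slice_pr1 : hom slice_prod_obj X :=
  exist (fun h : hom P (src X) => arr X ∘ h = arr X ∘ pb1 P) (pb1 P) erefl.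

Definition slice_pr2 : hom slice_prod_obj Y :=
  exist (fun h : hom P (src Y) => arr Y ∘ h = arr X ∘ pb1 P) (pb2 P)
    (esym (pb_comm P)).

Lemma slice_pair_comm (T : slice) (u : hom T X) (v : hom T Y) :
  arr X ∘ sval u = arr Y ∘ sval v.
Proof. by rewrite (svalP u) (svalP v). Qed.

Lemma slice_pair_subproof (T : slice) (u : hom T X) (v : hom T Y) :
  arr X ∘ pb1 P ∘ pb_lift P (slice_pair_comm u v) = arr T.
Proof. by rewrite -compcA pb1_lift (svalP u). Qed.

Definition slice_pair (T : slice) (u : hom T X) (v : hom T Y) :
    hom T slice_prod_obj :=
  exist (fun h : hom (src T) P => arr X ∘ pb1 P ∘ h = arr T)
    (pb_lift P (slice_pair_comm u v)) (slice_pair_subproof u v).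

Lemma slice_pr1_pair (T : slice) (u : hom T X) (v : hom T Y) :
  slice_pr1 ∘ slice_pair u v = u.
Proof. by apply: slice_hom_ext; exact: pb1_lift. Qed.

Lemma slice_pr2_pair (T : slice) (u : hom T X) (v : hom T Y) :
  slice_pr2 ∘ slice_pair u v = v.
Proof. by apply: slice_hom_ext; exact: pb2_lift. Qed.

Lemma slice_prod_uniq (T : slice) (h k : hom T slice_prod_obj) :
  slice_pr1 ∘ h = slice_pr1 ∘ k -> slice_pr2 ∘ h = slice_pr2 ∘ k -> h = k.
Proof.
move=> /(congr1 sval) e1 /(congr1 sval) e2.
by apply: slice_hom_ext; exact: pb_uniq e1 e2.
Qed.

Definition slice_prod : product X Y :=
  Product slice_pr1_pair slice_pr2_pair slice_prod_uniq.
End SliceProduct.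

Definition slice_products : finite_products slice :=
  FiniteProducts slice_term slice_prod.
End Slice.

Section AbelianGroupObjects.
Variables (D : category) (fp : finite_products D).

Local Notation "1" := (fp_term fp) : cat_scope.
Local Notation "a × b" := (fp_prod fp a b) (at level 40) : cat_scope.
Local Notation p1 := (pr1 (fp_prod fp _ _)).
Local Notation p2 := (pr2 (fp_prod fp _ _)).
Local Notation "⟨ u , v ⟩" := (pairc (fp_prod fp _ _) u v) : cat_scope.
Local Notation "!" := (bang (fp_term fp) _) : cat_scope.

Record ab_obj := AbObj {
  ab_car :> D;
  ab_zero : hom 1 ab_car;
  ab_opp : hom ab_car ab_car;
  ab_add : hom (ab_car × ab_car) ab_car;
  ab_addA : (* as maps G × (G × G) -> G *)
    ab_add ∘ ⟨p1, ab_add ∘ p2⟩ = ab_add ∘ ⟨ab_add ∘ ⟨p1, p1 ∘ p2⟩, p2 ∘ p2⟩;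
  ab_addC : ab_add ∘ ⟨p2, p1⟩ = ab_add;
  ab_add0 : ab_add ∘ ⟨ab_zero ∘ !, idc ab_car⟩ = idc ab_car;
  ab_addN : ab_add ∘ ⟨ab_opp, idc ab_car⟩ = ab_zero ∘ ! }.

Definition ab_hom (X Y : ab_obj) :=
  {h : hom X Y | h ∘ ab_add X = ab_add Y ∘ ⟨h ∘ p1, h ∘ p2⟩}.

Lemma ab_hom_ext (X Y : ab_obj) (h k : ab_hom X Y) : sval h = sval k -> h = k.
Proof. exact: sval_inj. Qed.

Lemma pairc_comp (a b s t : D) (u : hom t a) (v : hom t b) (w : hom s t) :
  ⟨u, v⟩ ∘ w = ⟨u ∘ w, v ∘ w⟩.
Proof.
by apply: prod_uniq; rewrite compcA ?pr1_pairc ?pr2_pairc.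
Qed.

Lemma pairc_id (a b : D) : ⟨pr1 (a × b), pr2 (a × b)⟩ = idc _.
Proof. by apply: prod_uniq; rewrite ?pr1_pairc ?pr2_pairc compc1. Qed.

Lemma ab_id_subproof (X : ab_obj) :
  idc X ∘ ab_add X = ab_add X ∘ ⟨idc X ∘ p1, idc X ∘ p2⟩.
Proof. by rewrite !comp1c pairc_id compc1. Qed.

Definition ab_id (X : ab_obj) : ab_hom X X := exist _ _ (ab_id_subproof X).

Lemma ab_comp_subproof (X Y Z : ab_obj) (g : ab_hom Y Z) (f : ab_hom X Y) :
  (sval g ∘ sval f) ∘ ab_add X =
  ab_add Z ∘ ⟨(sval g ∘ sval f) ∘ p1, (sval g ∘ sval f) ∘ p2⟩.
Proof.
rewrite -compcA (svalP f) compcA (svalP g) -compcA pairc_comp.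
by rewrite -!compcA pr1_pairc pr2_pairc.
Qed.

Definition ab_comp (X Y Z : ab_obj) (g : ab_hom Y Z) (f : ab_hom X Y) :
  ab_hom X Z := exist _ _ (ab_comp_subproof g f).

Lemma ab_compA (X Y Z T : ab_obj) (h : ab_hom Z T) (g : ab_hom Y Z)
    (f : ab_hom X Y) : ab_comp h (ab_comp g f) = ab_comp (ab_comp h g) f.
Proof. by apply: ab_hom_ext; exact: compcA. Qed.

Lemma ab_comp1 (X Y : ab_obj) (f : ab_hom X Y) : ab_comp (ab_id Y) f = f.
Proof. by apply: ab_hom_ext; exact: comp1c. Qed.

Lemma ab_1comp (X Y : ab_obj) (f : ab_hom X Y) : ab_comp f (ab_id X) = f.
Proof. by apply: ab_hom_ext; exact: compc1. Qed.

Definition ab_category : category :=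
  @Category ab_obj ab_hom ab_id ab_comp ab_compA ab_comp1 ab_1comp.

Section GeneralizedElements.
Variables (X : ab_obj) (T : D).
Implicit Types x y z : hom T X.

Definition gadd x y : hom T X := ab_add X ∘ ⟨x, y⟩.

Lemma gaddA x y z : gadd x (gadd y z) = gadd (gadd x y) z.
Proof.
have := congr1 (fun k => k ∘ ⟨x, ⟨y, z⟩⟩) (ab_addA X).
rewrite /= -!compcA !pairc_comp -!compcA !pairc_comp -!compcA.
by rewrite !(pr1_pairc, pr2_pairc).
Qed.

Lemma gaddC x y : gadd x y = gadd y x.
Proof.
by rewrite {1}/gadd -ab_addC -compcA pairc_comp pr1_pairc pr2_pairc.
Qed.

Lemma gadd0 x : gadd (ab_zero X ∘ !) x = x.
Proof.
have := congr1 (fun k => k ∘ x) (ab_add0 X).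
rewrite /= -compcA pairc_comp -compcA !comp1c.
by rewrite (bang_uniq (bang _ _ ∘ x) (bang _ T)).
Qed.

Lemma gaddN x : gadd (ab_opp X ∘ x) x = ab_zero X ∘ !.
Proof.
have := congr1 (fun k => k ∘ x) (ab_addN X).
rewrite /= -compcA pairc_comp -compcA !comp1c.
by rewrite (bang_uniq (bang _ _ ∘ x) (bang _ T)).
Qed.
End GeneralizedElements.
End AbelianGroupObjects.

Section GaddLemmas.
Variables (D : category) (fp : finite_products D).

Lemma gadd_comp (X : ab_obj fp) (S T : D) (x y : hom T X) (w : hom S T) :
  gadd x y ∘ w = gadd (x ∘ w) (y ∘ w).
Proof. by rewrite /gadd -compcA pairc_comp. Qed.

Lemma ab_hom_gadd (X Y : ab_obj fp) (h : ab_hom X Y) (T : D) (x y : hom T X) :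
  sval h ∘ gadd x y = gadd (sval h ∘ x) (sval h ∘ y).
Proof.
rewrite /gadd compcA (svalP h) -compcA pairc_comp.
by rewrite -!compcA pr1_pairc pr2_pairc.
Qed.

Lemma gadd_pr (X : ab_obj fp) :
  gadd (pr1 (fp_prod fp X X)) (pr2 (fp_prod fp X X)) = ab_add X.
Proof. by rewrite /gadd pairc_id compc1. Qed.
End GaddLemmas.

Section BaseChange.
Variables (C : category) (pb : pullbacks C) (A B : C) (f : hom A B).

(* Composition with f, left adjoint to the pullback functor C/B -> C/A; it
   describes the morphisms into a pullback. *)
Definition pushf (T : slice A) : slice B := SliceObj (f ∘ arr T).

Lemma pushf_subproof (S T : slice A) (w : hom S T) :
  arr (pushf T) ∘ sval w = arr (pushf S).
Proof. by rewrite /= -compcA (svalP w). Qed.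

Definition pushf_map (S T : slice A) (w : hom S T) : hom (pushf S) (pushf T) :=
  exist (fun h : hom (src S) (src T) => f ∘ arr T ∘ h = f ∘ arr S)
    (sval w) (pushf_subproof w).

Definition pullback_obj (Y : slice B) : slice A := SliceObj (pb1 (pb f (arr Y))).

Section Transpose.
Variable Y : slice B.
Let P := pb f (arr Y).

Lemma transpose_subproof (T : slice A) (x : hom T (pullback_obj Y)) :
  arr Y ∘ (pb2 P ∘ sval x) = arr (pushf T).
Proof. by rewrite compcA -pb_comm -compcA (svalP x). Qed.

Definition transpose (T : slice A) (x : hom T (pullback_obj Y)) :
    hom (pushf T) Y :=
  exist (fun h : hom (src T) (src Y) => arr Y ∘ h = f ∘ arr T)
    (pb2 P ∘ sval x) (transpose_subproof x).

Definition untranspose (T : slice A) (y : hom (pushf T) Y) :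
    hom T (pullback_obj Y) :=
  exist (fun h : hom (src T) P => pb1 P ∘ h = arr T)
    (pb_lift P (esym (svalP y))) (pb1_lift P (esym (svalP y))).

Lemma untransposeK (T : slice A) (y : hom (pushf T) Y) :
  transpose (untranspose y) = y.
Proof. by apply: slice_hom_ext; exact: pb2_lift. Qed.

Lemma transpose_inj (T : slice A) (x y : hom T (pullback_obj Y)) :
  transpose x = transpose y -> x = y.
Proof.
move=> /(congr1 sval) /= e; apply: slice_hom_ext; apply: (@pb_uniq _ _ _ _ _ _ P) => //.
by rewrite (svalP x) (svalP y).
Qed.

Lemma transpose_comp (S T : slice A) (x : hom T (pullback_obj Y)) (w : hom S T) :
  transpose (x ∘ w) = transpose x ∘ pushf_map w.
Proof. by apply: slice_hom_ext; exact: compcA. Qed.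
End Transpose.

Variable Y : ab_obj (slice_products B pb).

Let fpA := slice_products A pb.
Let fpB := slice_products B pb.
Let G : slice A := pullback_obj Y.

Definition bc_zero : hom (fp_term fpA) G :=
  untranspose (ab_zero Y ∘ bang (fp_term fpB) _).

Definition bc_opp : hom G G := untranspose (ab_opp Y ∘ transpose (idc G)).

Definition bc_add : hom (fp_prod fpA G G) G :=
  untranspose (ab_add Y ∘ pairc (fp_prod fpB Y Y)
    (transpose (pr1 (fp_prod fpA G G))) (transpose (pr2 (fp_prod fpA G G)))).

Lemma transpose_bc_add (T : slice A) (w : hom T (fp_prod fpA G G)) :
  transpose (bc_add ∘ w) =
  gadd (transpose (pr1 (fp_prod fpA G G) ∘ w))
       (transpose (pr2 (fp_prod fpA G G) ∘ w)).
Proof.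
by rewrite [LHS]transpose_comp untransposeK [LHS]gadd_comp -!transpose_comp.
Qed.

Lemma transpose_bc_zero (T : slice A) (w : hom T (fp_term fpA)) :
  transpose (bc_zero ∘ w) = ab_zero Y ∘ bang (fp_term fpB) _.
Proof.
rewrite [LHS]transpose_comp untransposeK -compcA; congr (_ ∘ _).
exact: bang_uniq.
Qed.

Lemma transpose_bc_opp (T : slice A) (w : hom T G) :
  transpose (bc_opp ∘ w) = ab_opp Y ∘ transpose w.
Proof.
by rewrite [LHS]transpose_comp untransposeK -compcA -transpose_comp comp1c.
Qed.

Lemma bc_addA :
  bc_add ∘ pairc (fp_prod fpA G G) (pr1 (fp_prod fpA G (fp_prod fpA G G)))
    (bc_add ∘ pr2 (fp_prod fpA G (fp_prod fpA G G))) =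
  bc_add ∘ pairc (fp_prod fpA G G)
    (bc_add ∘ pairc (fp_prod fpA G G)
       (pr1 (fp_prod fpA G (fp_prod fpA G G)))
       (pr1 (fp_prod fpA G G) ∘ pr2 (fp_prod fpA G (fp_prod fpA G G))))
    (pr2 (fp_prod fpA G G) ∘ pr2 (fp_prod fpA G (fp_prod fpA G G))).
Proof.
apply: transpose_inj.
rewrite !transpose_bc_add !pr1_pairc !pr2_pairc !transpose_bc_add.
by rewrite !pr1_pairc !pr2_pairc gaddA.
Qed.

Lemma bc_addC :
  bc_add ∘ pairc (fp_prod fpA G G)
    (pr2 (fp_prod fpA G G)) (pr1 (fp_prod fpA G G)) = bc_add.
Proof.
apply: transpose_inj; rewrite transpose_bc_add pr1_pairc pr2_pairc gaddC.
by rewrite -[RHS]/(transpose bc_add) untransposeK.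
Qed.

Lemma bc_add0 :
  bc_add ∘ pairc (fp_prod fpA G G) (bc_zero ∘ bang (fp_term fpA) G) (idc G) =
  idc G.
Proof.
apply: transpose_inj; rewrite transpose_bc_add pr1_pairc pr2_pairc.
by rewrite transpose_bc_zero gadd0.
Qed.

Lemma bc_addN :
  bc_add ∘ pairc (fp_prod fpA G G) bc_opp (idc G) =
  bc_zero ∘ bang (fp_term fpA) G.
Proof.
apply: transpose_inj; rewrite transpose_bc_add pr1_pairc pr2_pairc.
by rewrite -[bc_opp]compc1 transpose_bc_opp gaddN transpose_bc_zero.
Qed.

(* The abelian group object f^* Y in C/A. *)
Definition base_change : ab_obj fpA :=
  @AbObj _ fpA G bc_zero bc_opp bc_add bc_addA bc_addC bc_add0 bc_addN.

End BaseChange.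

Section Tangent.
Variables (C : category) (pb : pullbacks C).

Record tangent_obj := TangentObj {
  tbase : C;
  tfib : ab_obj (slice_products tbase pb) }.

Local Notation tot X := (ab_car (tfib X)).

Record tangent_hom (X Y : tangent_obj) := TangentHom {
  thbase : hom (tbase X) (tbase Y);
  thfib : ab_hom (tfib X) (base_change thbase (tfib Y)) }.

(* The composite X -> f^* Y -> Y in C. *)
Definition thtotal (X Y : tangent_obj) (h : tangent_hom X Y) :
    hom (src (tot X)) (src (tot Y)) :=
  sval (transpose (sval (thfib h))).

Lemma tangent_hom_ext (X Y : tangent_obj) (h k : tangent_hom X Y) :
  thbase h = thbase k -> thtotal h = thtotal k -> h = k.
Proof.
case: h k => [f u] [g v] /= e; case: _ / e v => v e; congr TangentHom.
by apply: ab_hom_ext; apply: transpose_inj; apply: slice_hom_ext.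
Qed.

Lemma thtotal_comm (X Y : tangent_obj) (h : tangent_hom X Y) :
  arr (tot Y) ∘ thtotal h = thbase h ∘ arr (tot X).
Proof. exact: (svalP (transpose (sval (thfib h)))). Qed.

Section TotalHom.
Variables (X Y : tangent_obj) (f : hom (tbase X) (tbase Y))
  (u : hom (pushf f (tot X)) (tot Y)).

Let XX := fp_prod (slice_products (tbase X) pb) (tot X) (tot X).

Definition additive_over : Prop :=
  u ∘ pushf_map f (ab_add (tfib X)) =
  gadd (u ∘ pushf_map f (pr1 XX)) (u ∘ pushf_map f (pr2 XX)).

Hypothesis u_add : additive_over.

Lemma tangent_hom_of_subproof :
  (untranspose pb u : hom (tot X) (ab_car (base_change f (tfib Y))))
    ∘ ab_add (tfib X) =
  ab_add (base_change f (tfib Y)) ∘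
    pairc (fp_prod (slice_products (tbase X) pb) _ _)
      ((untranspose pb u : hom (tot X) (ab_car (base_change f (tfib Y))))
         ∘ pr1 XX)
      (untranspose pb u ∘ pr2 XX).
Proof.
apply: transpose_inj; rewrite [RHS]transpose_bc_add pr1_pairc pr2_pairc.
by rewrite !transpose_comp untransposeK.
Qed.

Definition tangent_hom_of : tangent_hom X Y :=
  TangentHom (exist _ (untranspose pb u) tangent_hom_of_subproof).

Lemma thtotal_of : thtotal tangent_hom_of = sval u.
Proof. by rewrite /thtotal /= pb2_lift. Qed.
End TotalHom.

Lemma sval_gadd (A : C) (Z : ab_obj (slice_products A pb)) (t : C)
    (a b : hom t A) (x y : hom (SliceObj a : slice A) Z)
    (x' y' : hom (SliceObj b : slice A) Z) :
  sval x = sval x' -> sval y = sval y' -> sval (gadd x y) = sval (gadd x' y').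
Proof. by move=> ex ey; congr (_ ∘ _); apply: pb_lift_eq. Qed.

Lemma thtotal_add (X Y : tangent_obj) (h : tangent_hom X Y) (T : slice (tbase X))
    (x y : hom T (tot X)) :
  thtotal h ∘ sval (gadd x y) =
  sval (gadd (transpose (sval (thfib h)) ∘ pushf_map (thbase h) x)
             (transpose (sval (thfib h)) ∘ pushf_map (thbase h) y)).
Proof.
have := congr1 (@transpose _ pb _ _ _ _ _) (ab_hom_gadd (thfib h) x y).
rewrite [RHS]transpose_bc_add pr1_pairc pr2_pairc !transpose_comp.
by move=> <-.
Qed.

Section Id.
Variable X : tangent_obj.

Lemma tangent_id_comm :
  arr (tot X) ∘ idc (src (tot X)) = idc (tbase X) ∘ arr (tot X).
Proof. by rewrite compc1 comp1c. Qed.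

Definition tangent_id_total : hom (pushf (idc (tbase X)) (tot X)) (tot X) :=
  exist (fun h : hom (src (tot X)) (src (tot X)) =>
           arr (tot X) ∘ h = idc (tbase X) ∘ arr (tot X))
    (idc (src (tot X))) tangent_id_comm.

Lemma tangent_id_additive : additive_over tangent_id_total.
Proof.
apply: slice_hom_ext; rewrite /= comp1c -[LHS]compc1; congr (_ ∘ _).
by apply: pb_uniq; rewrite ?pb1_lift ?pb2_lift compc1 comp1c.
Qed.

Definition tangent_id : tangent_hom X X := tangent_hom_of tangent_id_additive.
End Id.

(* The composite of (f, φ) and (g, ψ) is (g ∘ f, χ), where χ is
   X -φ-> f^* Y -f^*ψ-> f^* g^* Z ≅ (g ∘ f)^* Z; this is the morphism into the
   pullback (g ∘ f)^* Z whose projection to Z is X -> Y -> Z. *)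
Section Comp.
Variables (X Y Z : tangent_obj) (g : tangent_hom Y Z) (f : tangent_hom X Y).

Lemma tangent_comp_comm :
  arr (tot Z) ∘ (thtotal g ∘ thtotal f) =
  (thbase g ∘ thbase f) ∘ arr (tot X).
Proof. by rewrite compcA thtotal_comm -compcA thtotal_comm compcA. Qed.

Definition tangent_comp_total :
    hom (pushf (thbase g ∘ thbase f) (tot X)) (tot Z) :=
  exist (fun h : hom (src (tot X)) (src (tot Z)) =>
           arr (tot Z) ∘ h = (thbase g ∘ thbase f) ∘ arr (tot X))
    (thtotal g ∘ thtotal f) tangent_comp_comm.

Lemma tangent_comp_additive : additive_over tangent_comp_total.
Proof.
set p1 := pr1 (fp_prod (slice_products _ pb) (tot X) (tot X)).
set p2 := pr2 (fp_prod (slice_products _ pb) (tot X) (tot X)).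
apply: slice_hom_ext; rewrite -[LHS]compcA.
have := thtotal_add f p1 p2; rewrite gadd_pr => e.
apply: etrans (congr1 (compc (thtotal g)) e) _.
pose tr p := transpose (sval (thfib f)) ∘ pushf_map (thbase f) p.
apply: etrans (thtotal_add g (tr _ p1) (tr _ p2)) _.
pose P : slice _ := fp_prod (slice_products _ pb) (tot X) (tot X).
by apply: (@sval_gadd _ (tfib Z) (src P)
  (thbase g ∘ (thbase f ∘ arr P)) ((thbase g ∘ thbase f) ∘ arr P));
  exact: compcA.
Qed.

Definition tangent_comp : tangent_hom X Z :=
  tangent_hom_of tangent_comp_additive.
End Comp.

Lemma tangent_compA (X Y Z T : tangent_obj) (h : tangent_hom Z T)
    (g : tangent_hom Y Z) (f : tangent_hom X Y) :
  tangent_comp h (tangent_comp g f) = tangent_comp (tangent_comp h g) f.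
Proof.
by apply: tangent_hom_ext; rewrite ?thtotal_of /= ?thtotal_of /= compcA.
Qed.

Lemma tangent_comp1 (X Y : tangent_obj) (f : tangent_hom X Y) :
  tangent_comp (tangent_id Y) f = f.
Proof.
by apply: tangent_hom_ext; rewrite ?thtotal_of /= ?thtotal_of /= comp1c.
Qed.

Lemma tangent_1comp (X Y : tangent_obj) (f : tangent_hom X Y) :
  tangent_comp f (tangent_id X) = f.
Proof.
by apply: tangent_hom_ext; rewrite ?thtotal_of /= ?thtotal_of /= compc1.
Qed.

Definition tangent_category : category :=
  @Category tangent_obj tangent_hom tangent_id tangent_comp
    tangent_compA tangent_comp1 tangent_1comp.

Definition tangent_proj : functor tangent_category C :=
  @Functor tangent_category C tbase thbase (fun X => erefl)
    (fun X Y Z g f => erefl).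

End Tangent.

(* F(x) = G(y) on objects is Leibniz equality, so F(x) = G(y) on morphisms only
   typechecks after transport along the equalities of the endpoints. *)
Definition cast_hom (C : category) (a a' b b' : C) (ea : a = a') (eb : b = b')
    (f : hom a b) : hom a' b' :=
  match ea in _ = x, eb in _ = y return hom x y with
  | erefl, erefl => f
  end.

Section StrictPullback.
Variables (A B C : category) (F : functor A C) (G : functor B C).

Record spb_obj := SpbObj {
  spb_fst : A;
  spb_snd : B;
  spb_eq : F spb_fst = G spb_snd }.

Definition spb_hom (x y : spb_obj) :=
  {h : hom (spb_fst x) (spb_fst y) * hom (spb_snd x) (spb_snd y) |
    cast_hom (spb_eq x) (spb_eq y) (fmap F h.1) = fmap G h.2}.

Lemma spb_id_subproof (x : spb_obj) :
  cast_hom (spb_eq x) (spb_eq x) (fmap F (idc (spb_fst x))) =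
  fmap G (idc (spb_snd x)).
Proof. by rewrite !fmap_id; case: _ / (spb_eq x). Qed.

Definition spb_id (x : spb_obj) : spb_hom x x :=
  exist _ (idc (spb_fst x), idc (spb_snd x)) (spb_id_subproof x).

Lemma cast_hom_comp (a a' b b' c c' : C) (ea : a = a') (eb : b = b')
    (ec : c = c') (g : hom b c) (f : hom a b) :
  cast_hom ea ec (g ∘ f) = cast_hom eb ec g ∘ cast_hom ea eb f.
Proof. by case: _ / ea; case: _ / eb; case: _ / ec. Qed.

Lemma spb_comp_subproof (x y z : spb_obj) (g : spb_hom y z) (f : spb_hom x y) :
  cast_hom (spb_eq x) (spb_eq z) (fmap F ((sval g).1 ∘ (sval f).1)) =
  fmap G ((sval g).2 ∘ (sval f).2).
Proof.
by rewrite !fmap_comp (cast_hom_comp _ (spb_eq y)) (svalP g) (svalP f).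
Qed.

Definition spb_comp (x y z : spb_obj) (g : spb_hom y z) (f : spb_hom x y) :
    spb_hom x z :=
  exist _ ((sval g).1 ∘ (sval f).1, (sval g).2 ∘ (sval f).2)
    (spb_comp_subproof g f).

Lemma spb_compA (x y z t : spb_obj) (h : spb_hom z t) (g : spb_hom y z)
    (f : spb_hom x y) : spb_comp h (spb_comp g f) = spb_comp (spb_comp h g) f.
Proof. by apply: sval_inj; rewrite /= !compcA. Qed.

Lemma spb_comp1 (x y : spb_obj) (f : spb_hom x y) : spb_comp (spb_id y) f = f.
Proof. by apply: sval_inj; rewrite /= !comp1c -surjective_pairing. Qed.

Lemma spb_1comp (x y : spb_obj) (f : spb_hom x y) : spb_comp f (spb_id x) = f.
Proof. by apply: sval_inj; rewrite /= !compc1 -surjective_pairing. Qed.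

Definition category_pullback : category :=
  @Category spb_obj spb_hom spb_id spb_comp spb_compA spb_comp1 spb_1comp.
End StrictPullback.

Local Open Scope ring_scope.
Local Open Scope classical_set_scope.
Local Open Scope cat_scope.

Section Smooth.
Variable R : realType.

(* f is C^(k+1) when it is differentiable with all directional derivatives of
   class C^k; this is the usual notion because the domain is
   finite-dimensional. *)
Fixpoint Ck (n : nat) (W : normedModType R) (k : nat) (f : 'rV[R]_n -> W) :
    Prop :=
  match k with
  | 0 => continuous f
  | k'.+1 => (forall x, differentiable f x) /\ forall v, Ck k' ('D_v f)
  end.

Definition smooth (n m : nat) (f : 'rV[R]_n -> 'rV[R]_m) : Prop :=
  forall k, Ck k f.

Section CkLemmas.
Variable n : nat.
Implicit Types W : normedModType R.

Lemma Ck_continuous W k (f : 'rV[R]_n -> W) : Ck k f -> continuous f.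
Proof.
by case: k => [//|k] [df _] x; exact: differentiable_continuous.
Qed.

Lemma CkS W k (f : 'rV[R]_n -> W) : Ck k.+1 f -> Ck k f.
Proof.
elim: k f => [|k IH] f; first exact: Ck_continuous.
by move=> [df Df]; split=> // v; exact: IH.
Qed.

Lemma Ck_cst W (c : W) k : Ck k (fun _ : 'rV[R]_n => c).
Proof.
elim: k c => [|k IH] c; first by move=> x; exact: cst_continuous.
split=> [x|v]; first exact: differentiable_cst.
have -> : 'D_v (fun=> c) = fun _ : 'rV[R]_n => (0 : W).
  by apply/funext => x; exact: derive_cst.
exact: IH.
Qed.

Lemma Ck_lin W W' (L : {linear W -> W'}) k (f : 'rV[R]_n -> W) :
  continuous L -> Ck k f -> Ck k (fun x => L (f x)).
Proof.
move=> Lc; elim: k f => [|k IH] f.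
  by move=> fc x; apply: continuous_comp; [exact: fc|exact: Lc].
move=> [df Df]; have dL y : differentiable L y by exact: linear_differentiable.
have dLf x : differentiable (fun x => L (f x)) x.
  exact: (@differentiable_comp _ _ _ _ f L).
split=> // v.
have -> : 'D_v (fun x => L (f x)) = fun x => L ('D_v f x).
  apply/funext => x; rewrite deriveE// deriveE//.
  by rewrite (@diff_comp _ _ _ _ f L)//= diff_lin.
exact/IH/Df.
Qed.

Lemma Ck_add W k (f g : 'rV[R]_n -> W) :
  Ck k f -> Ck k g -> Ck k (fun x => f x + g x).
Proof.
elim: k f g => [|k IH] f g; first by move=> fc gc x; exact: cvgD (fc x) (gc x).
move=> [df Df] [dg Dg]; split=> [x|v]; first exact: differentiableD.
have -> : 'D_v (fun x => f x + g x) = fun x => 'D_v f x + 'D_v g x.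
  by apply/funext => x; rewrite -deriveD//; exact: diff_derivable.
by apply: IH; [exact: Df|exact: Dg].
Qed.

Lemma Ck_sum W k (I : finType) (f : I -> 'rV[R]_n -> W) :
  (forall i, Ck k (f i)) -> Ck k (fun x => \sum_i f i x).
Proof.
move=> fk; elim: (index_enum I) => [|i s IH].
  have -> : (fun x => \sum_(i <- [::]) f i x) = fun=> 0.
    by apply/funext => x; rewrite big_nil.
  exact: Ck_cst.
have -> : (fun x => \sum_(i <- i :: s) f i x) =
          (fun x => f i x + \sum_(i <- s) f i x).
  by apply/funext => x; rewrite big_cons.
exact: Ck_add.
Qed.

Lemma Ck_mul k (f g : 'rV[R]_n -> R) :
  Ck k f -> Ck k g -> Ck k (fun x => f x * g x).
Proof.
elim: k f g => [|k IH] f g; first by move=> fc gc x; exact: cvgM (fc x) (gc x).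
move=> fk gk; have [[df Df] [dg Dg]] := (fk, gk).
split=> [x|v]; first exact: differentiableM.
have -> : 'D_v (fun x => f x * g x) =
          fun x => f x * 'D_v g x + g x * 'D_v f x.
  by apply/funext => x; rewrite -deriveM//; exact: diff_derivable.
by apply: Ck_add; apply: IH; try exact: CkS; [exact: Dg|exact: Df].
Qed.

Definition entry m (j : 'I_m) (x : 'rV[R]_m) : R := x 0 j.

Lemma entry_is_linear m (j : 'I_m) : linear (entry j).
Proof. by move=> a x y; rewrite /entry !mxE. Qed.

HB.instance Definition _ m (j : 'I_m) :=
  GRing.isLinear.Build R 'rV[R]_m R _ (entry j) (entry_is_linear j).

Definition axis m (j : 'I_m) (a : R) : 'rV[R]_m := a *: delta_mx 0 j.

Lemma axis_is_linear m (j : 'I_m) : linear (axis j).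
Proof. by move=> a x y; rewrite /axis scalerDl scalerA. Qed.

HB.instance Definition _ m (j : 'I_m) :=
  GRing.isLinear.Build R R 'rV[R]_m _ (axis j) (axis_is_linear j).

Lemma Ck_entry m k (f : 'rV[R]_n -> 'rV[R]_m) j :
  Ck k f -> Ck k (fun x => f x 0 j).
Proof.
by move=> fk; apply: (@Ck_lin _ _ (entry j)) => //; exact: coord_continuous.
Qed.

Lemma Ck_row m k (f : 'rV[R]_n -> 'rV[R]_m) :
  (forall j, Ck k (fun x => f x 0 j)) -> Ck k f.
Proof.
move=> fk; have -> : f = fun x => \sum_j axis j (f x 0 j).
  by apply/funext => x; exact: row_sum_delta.
apply: Ck_sum => j; apply: (@Ck_lin _ _ (axis j)) => //.
exact: scalel_continuous.
Qed.
End CkLemmas.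

Lemma Ck_comp n m p k (g : 'rV[R]_m -> 'rV[R]_p) (f : 'rV[R]_n -> 'rV[R]_m) :
  Ck k g -> Ck k f -> Ck k (fun x => g (f x)).
Proof.
elim: k g f => [|k IH] g f.
  by move=> gc fc x; apply: continuous_comp; [exact: fc|exact: gc].
move=> gk fk; have [[dg Dg] [df Df]] := (gk, fk).
split=> [x|v]; first exact: (@differentiable_comp _ _ _ _ f g).
have -> : 'D_v (fun x => g (f x)) =
    fun x => \sum_j 'D_v f x 0 j *: 'D_(delta_mx 0 j) g (f x).
  apply/funext => x; rewrite deriveE; last first.
    exact: (@differentiable_comp _ _ _ _ f g).
  rewrite (@diff_comp _ _ _ _ f g)//= -(deriveE v (df x)).
  rewrite [X in 'd g _ X]row_sum_delta linear_sum.
  by apply: eq_bigr => j _; rewrite linearZ/= (deriveE _ (dg (f x))).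
apply: Ck_row => i.
have -> : (fun x => (\sum_j 'D_v f x 0 j *: 'D_(delta_mx 0 j) g (f x)) 0 i) =
    fun x => \sum_j 'D_v f x 0 j * 'D_(delta_mx 0 j) g (f x) 0 i.
  by apply/funext => x; rewrite summxE; apply: eq_bigr => j _; rewrite mxE.
apply: Ck_sum => j; apply: Ck_mul; first exact/Ck_entry/Df.
apply: (@Ck_entry _ _ _ (fun x => 'D_(delta_mx 0 j) g (f x))).
exact: (IH ('D_(delta_mx 0 j) g) f (Dg _) (CkS fk)).
Qed.

Lemma smooth_comp n m p (g : 'rV[R]_m -> 'rV[R]_p) (f : 'rV[R]_n -> 'rV[R]_m) :
  smooth g -> smooth f -> smooth (fun x => g (f x)).
Proof. by move=> gs fs k; exact: Ck_comp. Qed.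

Lemma Ck_coord n (j : 'I_n) k : Ck k (fun x : 'rV[R]_n => x 0 j).
Proof.
case: k => [|k]; first exact: coord_continuous.
split=> [x|v]; first exact: differentiable_coord.
have -> : 'D_v (fun x : 'rV[R]_n => x 0 j) = fun=> v 0 j.
  apply/funext => x; rewrite deriveE; last exact: differentiable_coord.
  by rewrite (@diff_lin _ _ _ (entry j))//; exact: coord_continuous.
exact: Ck_cst.
Qed.

Lemma smooth_id n : smooth (fun x : 'rV[R]_n => x).
Proof. by move=> k; apply: Ck_row => j; exact: Ck_coord. Qed.
End Smooth.

Section Euclidean.
Variable R : realType.

Definition smooth_map (n m : nat) := {f : 'rV[R]_n -> 'rV[R]_m | smooth f}.

Definition smooth_map_id (n : nat) : smooth_map n n :=
  exist _ (fun x => x) (@smooth_id R n).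

Definition smooth_map_comp (n m p : nat) (g : smooth_map m p)
    (f : smooth_map n m) : smooth_map n p :=
  exist _ (fun x => sval g (sval f x)) (smooth_comp (svalP g) (svalP f)).

Lemma smooth_map_compA (n m p q : nat) (h : smooth_map p q) (g : smooth_map m p)
    (f : smooth_map n m) :
  smooth_map_comp h (smooth_map_comp g f) =
  smooth_map_comp (smooth_map_comp h g) f.
Proof. exact: sval_inj. Qed.

Lemma smooth_map_comp1 (n m : nat) (f : smooth_map n m) :
  smooth_map_comp (smooth_map_id m) f = f.
Proof. exact: sval_inj. Qed.

Lemma smooth_map_1comp (n m : nat) (f : smooth_map n m) :
  smooth_map_comp f (smooth_map_id n) = f.
Proof. exact: sval_inj. Qed.

(* The object n stands for R^n. *)
Definition euclidean_category : category :=
  @Category nat smooth_map smooth_map_id smooth_map_comp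
    smooth_map_compA smooth_map_comp1 smooth_map_1comp.
End Euclidean.

Section EuclideanProducts.
Variable R : realType.
Local Notation E := (euclidean_category R).

Lemma smooth_add n m (f g : 'rV[R]_n -> 'rV[R]_m) :
  smooth f -> smooth g -> smooth (fun x => f x + g x).
Proof. by move=> fs gs k; exact: Ck_add. Qed.

Lemma smooth_mul n (f g : 'rV[R]_n -> 'rV[R]_1) :
  smooth f -> smooth g -> smooth (fun x => \row_j (f x 0 j * g x 0 j)).
Proof.
move=> fs gs k; apply: Ck_row => j.
have -> : (fun x => (\row_j (f x 0 j * g x 0 j)) 0 j) =
          (fun x => f x 0 j * g x 0 j) by apply/funext => x; rewrite mxE.
by apply: Ck_mul; apply: Ck_entry.
Qed.

Lemma smooth_opp n m (f : 'rV[R]_n -> 'rV[R]_m) :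
  smooth f -> smooth (fun x => - f x).
Proof.
move=> fs k; apply: (@Ck_lin _ _ _ _ (-%R : 'rV[R]_m -> 'rV[R]_m)) => //.
exact: opp_continuous.
Qed.

Lemma smooth_lsubmx n m : smooth (@lsubmx R 1 n m).
Proof.
move=> k; apply: Ck_row => j.
have -> : (fun x : 'rV[R]_(n + m) => lsubmx x 0 j) =
          (fun x => x 0 (lshift m j)) by apply/funext => x; rewrite mxE.
exact: Ck_coord.
Qed.

Lemma smooth_rsubmx n m : smooth (@rsubmx R 1 n m).
Proof.
move=> k; apply: Ck_row => j.
have -> : (fun x : 'rV[R]_(n + m) => rsubmx x 0 j) =
          (fun x => x 0 (rshift n j)) by apply/funext => x; rewrite mxE.
exact: Ck_coord.
Qed.

Lemma smooth_row_mx n m p (f : 'rV[R]_p -> 'rV[R]_n) (g : 'rV[R]_p -> 'rV[R]_m) :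
  smooth f -> smooth g -> smooth (fun x => row_mx (f x) (g x)).
Proof.
move=> fs gs k; apply: Ck_row => j; rewrite -(splitK j).
case: (split j) => i /=.
  have -> : (fun x => row_mx (f x) (g x) 0 (lshift m i)) = (fun x => f x 0 i).
    by apply/funext => x; rewrite row_mxEl.
  exact: Ck_entry.
have -> : (fun x => row_mx (f x) (g x) 0 (rshift n i)) = (fun x => g x 0 i).
  by apply/funext => x; rewrite row_mxEr.
exact: Ck_entry.
Qed.

Definition eucl_fst (n m : nat) : @hom E (n + m)%N n :=
  exist _ (@lsubmx R 1 n m) (@smooth_lsubmx n m).

Definition eucl_snd (n m : nat) : @hom E (n + m)%N m :=
  exist _ (@rsubmx R 1 n m) (@smooth_rsubmx n m).

Definition eucl_pair (p n m : nat) (f : @hom E p n) (g : @hom E p m) :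
    @hom E p (n + m)%N :=
  exist _ (fun x => row_mx (sval f x) (sval g x))
    (smooth_row_mx (svalP f) (svalP g)).

Lemma eucl_hom_ext (n m : nat) (f g : @hom E n m) :
  (forall x, sval f x = sval g x) -> f = g.
Proof. by move=> fg; apply: sval_inj; exact/funext. Qed.

Lemma eucl_fst_pair (p n m : nat) (f : @hom E p n) (g : @hom E p m) :
  eucl_fst n m ∘ eucl_pair f g = f.
Proof. by apply: eucl_hom_ext => x; exact: row_mxKl. Qed.

Lemma eucl_snd_pair (p n m : nat) (f : @hom E p n) (g : @hom E p m) :
  eucl_snd n m ∘ eucl_pair f g = g.
Proof. by apply: eucl_hom_ext => x; exact: row_mxKr. Qed.

Lemma eucl_product (n m : nat) : is_product (eucl_fst n m) (eucl_snd n m).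
Proof.
move=> p f g; exists (eucl_pair f g); split.
  by rewrite eucl_fst_pair eucl_snd_pair.
move=> h [<- <-]; apply: eucl_hom_ext => x /=; exact: hsubmxK.
Qed.

Lemma eucl_terminal : is_terminal (0%N : E).
Proof.
move=> n; exists (exist _ (fun _ => 0) (@Ck_cst R n _ 0)); split=> // h _.
by apply: eucl_hom_ext => x; apply/rowP => -[].
Qed.

Definition eucl_add : @hom E (1 + 1)%N 1%N :=
  exist _ (fun x => lsubmx x + rsubmx x)
    (smooth_add (@smooth_lsubmx 1 1) (@smooth_rsubmx 1 1)).

Definition eucl_mul : @hom E (1 + 1)%N 1%N :=
  exist _ (fun x => \row_j (lsubmx x 0 j * rsubmx x 0 j))
    (smooth_mul (@smooth_lsubmx 1 1) (@smooth_rsubmx 1 1)).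

Definition eucl_opp : @hom E 1%N 1%N :=
  exist _ (fun x => - x) (smooth_opp (@smooth_id R 1)).

Definition eucl_cst (n : nat) (a : R) : @hom E n 1%N :=
  exist _ (fun _ => const_mx a) (@Ck_cst R n _ (const_mx a)).
End EuclideanProducts.

Definition cinf_ring_category (R : realType) : category :=
  full_subcategory
    (C := functor_category (euclidean_category R) set_category)
    (@product_preserving (euclidean_category R) set_category).

Lemma set_terminalP (S : Type) :
  @is_terminal set_category S <-> exists x : S, forall y : S, x = y.
Proof.
split=> [/(_ unit)[h [_ hu]]|[x xu] T].
  exists (h tt) => y.
  by have /(congr1 (fun k => k tt)) := hu (fun=> y) Logic.I.
by exists (fun=> x); split=> // h _; apply/funext => t; exact: xu.
Qed.

Lemma set_productP (S T P : Type) (p1 : P -> S) (p2 : P -> T) :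
  @is_product set_category S T P p1 p2 <->
  (forall x y, exists! z, p1 z = x /\ p2 z = y).
Proof.
split=> [H x y|H U u v].
  have [h [[h1 h2] hu]] := H unit (fun=> x) (fun=> y).
  exists (h tt); split.
    by split; [exact: (congr1 (fun k => k tt) h1)|
               exact: (congr1 (fun k => k tt) h2)].
  move=> z [zx zy]; suff /(congr1 (fun k => k tt)) : h = fun=> z by [].
  by apply: hu; split; apply/funext.
have Hc t : {z | unique (fun z => p1 z = u t /\ p2 z = v t) z}.
  exact: cid (H _ _).
exists (fun t => sval (Hc t)); split.
  by split; apply/funext => t /=; have [[]] := svalP (Hc t).
move=> h [hu hv]; apply/funext => t; have [_] := svalP (Hc t); apply.
by rewrite -hu -hv.
Qed.

Section UnderlyingRing.
Variable R : realType.
Local Notation E := (euclidean_category R).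

Section Operations.
Variable A : cinf_ring_category R.
Let F : functor E set_category := sval A.

(* A(R) *)
Definition cinf_car : Type := F 1%N.

(* The inverse of the bijection A(R^n x R^m) -> A(R^n) x A(R^m). *)
Definition cinf_pair (n m : nat) (x : F n) (y : F m) : F (n + m)%N :=
  sval (cid ((set_productP _ _).1
    ((svalP A).2 _ _ _ _ _ (@eucl_product R n m)) x y)).

(* The unique element of A(R^0). *)
Definition cinf_pt : F 0%N :=
  sval (cid ((set_terminalP _).1 ((svalP A).1 _ (@eucl_terminal R)))).

Definition cinf_add (x y : cinf_car) : cinf_car :=
  fmap F (eucl_add R) (cinf_pair x y).
Definition cinf_mul (x y : cinf_car) : cinf_car :=
  fmap F (eucl_mul R) (cinf_pair x y).
Definition cinf_opp (x : cinf_car) : cinf_car := fmap F (eucl_opp R) x.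
Definition cinf_zero : cinf_car := fmap F (eucl_cst 0 0) cinf_pt.
Definition cinf_one : cinf_car := fmap F (eucl_cst 0 1) cinf_pt.

Lemma cinf_pairP (n m : nat) (x : F n) (y : F m) (z : F (n + m)%N) :
  fmap F (eucl_fst R n m) z = x -> fmap F (eucl_snd R n m) z = y ->
  cinf_pair x y = z.
Proof.
by rewrite /cinf_pair; case: cid => t /= [_ tu] zx zy; exact: tu.
Qed.

Lemma cinf_fst_pair (n m : nat) (x : F n) (y : F m) :
  fmap F (eucl_fst R n m) (cinf_pair x y) = x.
Proof. by rewrite /cinf_pair; case: cid => t /= [[]]. Qed.

Lemma cinf_snd_pair (n m : nat) (x : F n) (y : F m) :
  fmap F (eucl_snd R n m) (cinf_pair x y) = y.
Proof. by rewrite /cinf_pair; case: cid => t /= [[]]. Qed.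

Lemma cinf_ptP (x : F 0%N) : cinf_pt = x.
Proof. by rewrite /cinf_pt; case: cid. Qed.

Lemma fmapE (n m p : E) (g : hom m p) (f : hom n m) (t : F n) :
  fmap F (g ∘ f) t = fmap F g (fmap F f t).
Proof. by rewrite fmap_comp. Qed.

Lemma cinf_pair_fmap (n m p : E) (f : hom p n) (g : hom p m) (t : F p) :
  cinf_pair (fmap F f t) (fmap F g t) = fmap F (eucl_pair f g) t.
Proof.
by apply: cinf_pairP; rewrite -fmapE ?eucl_fst_pair ?eucl_snd_pair.
Qed.

Lemma cinf_add_fmap (p : E) (f g : hom p 1%N) (t : F p) :
  cinf_add (fmap F f t) (fmap F g t) = fmap F (eucl_add R ∘ eucl_pair f g) t.
Proof. by rewrite /cinf_add cinf_pair_fmap fmapE. Qed.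

Lemma cinf_mul_fmap (p : E) (f g : hom p 1%N) (t : F p) :
  cinf_mul (fmap F f t) (fmap F g t) = fmap F (eucl_mul R ∘ eucl_pair f g) t.
Proof. by rewrite /cinf_mul cinf_pair_fmap fmapE. Qed.

Lemma cinf_opp_fmap (p : E) (f : hom p 1%N) (t : F p) :
  cinf_opp (fmap F f t) = fmap F (eucl_opp R ∘ f) t.
Proof. by rewrite /cinf_opp fmapE. Qed.

Lemma cinf_cst_fmap (p : E) (a : R) (t : F p) :
  fmap F (eucl_cst 0 a) cinf_pt = fmap F (eucl_cst p a) t.
Proof.
have [z _] := @eucl_terminal R p.
by rewrite (cinf_ptP (fmap F z t)) -fmapE; congr (fmap F _ t); exact: sval_inj.
Qed.

Lemma cinf_fmap3 (x y z : cinf_car) :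
  exists (t : F (1 + 1 + 1)%N) (f g h : @hom E (1 + 1 + 1)%N 1%N),
    [/\ x = fmap F f t, y = fmap F g t & z = fmap F h t].
Proof.
exists (cinf_pair (cinf_pair x y) z).
exists (eucl_fst R 1 1 ∘ eucl_fst R (1 + 1) 1).
exists (eucl_snd R 1 1 ∘ eucl_fst R (1 + 1) 1).
exists (eucl_snd R (1 + 1) 1).
by rewrite !fmapE !(cinf_fst_pair, cinf_snd_pair).
Qed.

Let cinfE := (cinf_add_fmap, cinf_mul_fmap, cinf_opp_fmap).

Lemma cinf_addA : associative cinf_add.
Proof.
move=> x y z; have [t [f [g [h [-> -> ->]]]]] := cinf_fmap3 x y z.
rewrite !cinfE; congr (fmap F _ t); apply: eucl_hom_ext => v /=.
by rewrite !(row_mxKl, row_mxKr) addrA.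
Qed.

Lemma cinf_addC : commutative cinf_add.
Proof.
move=> x y; have [t [f [g [h [-> -> _]]]]] := cinf_fmap3 x y x.
rewrite !cinfE; congr (fmap F _ t); apply: eucl_hom_ext => v /=.
by rewrite !(row_mxKl, row_mxKr) addrC.
Qed.

Lemma cinf_add0 : left_id cinf_zero cinf_add.
Proof.
move=> x; have [t [f [g [h [-> _ _]]]]] := cinf_fmap3 x x x.
rewrite /cinf_zero (cinf_cst_fmap _ t) !cinfE; congr (fmap F _ t).
apply: eucl_hom_ext => v /=; rewrite !(row_mxKl, row_mxKr).
by apply/rowP => j; rewrite !mxE add0r.
Qed.

Lemma cinf_addN : left_inverse cinf_zero cinf_opp cinf_add.
Proof.
move=> x; have [t [f [g [h [-> _ _]]]]] := cinf_fmap3 x x x.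
rewrite /cinf_zero (cinf_cst_fmap _ t) !cinfE; congr (fmap F _ t).
apply: eucl_hom_ext => v /=; rewrite !(row_mxKl, row_mxKr).
by apply/rowP => j; rewrite !mxE addNr.
Qed.

Lemma cinf_mulA : associative cinf_mul.
Proof.
move=> x y z; have [t [f [g [h [-> -> ->]]]]] := cinf_fmap3 x y z.
rewrite !cinfE; congr (fmap F _ t); apply: eucl_hom_ext => v /=.
by apply/rowP => j; rewrite !(row_mxKl, row_mxKr, mxE) mulrA.
Qed.

Lemma cinf_mulC : commutative cinf_mul.
Proof.
move=> x y; have [t [f [g [h [-> -> _]]]]] := cinf_fmap3 x y x.
rewrite !cinfE; congr (fmap F _ t); apply: eucl_hom_ext => v /=.
by apply/rowP => j; rewrite !(row_mxKl, row_mxKr, mxE) mulrC.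
Qed.

Lemma cinf_mul1 : left_id cinf_one cinf_mul.
Proof.
move=> x; have [t [f [g [h [-> _ _]]]]] := cinf_fmap3 x x x.
rewrite /cinf_one (cinf_cst_fmap _ t) !cinfE; congr (fmap F _ t).
apply: eucl_hom_ext => v /=.
by apply/rowP => j; rewrite !(row_mxKl, row_mxKr, mxE) mul1r.
Qed.

Lemma cinf_mulDl : left_distributive cinf_mul cinf_add.
Proof.
move=> x y z; have [t [f [g [h [-> -> ->]]]]] := cinf_fmap3 x y z.
rewrite !cinfE; congr (fmap F _ t); apply: eucl_hom_ext => v /=.
by apply/rowP => j; rewrite !(row_mxKl, row_mxKr, mxE) mulrDl.
Qed.
End Operations.

(* comPzRingType carries decidable equality and a choice operator; on A(R) they
   come from the classical axioms. *)
HB.instance Definition _ A := gen_eqMixin (cinf_car A).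
HB.instance Definition _ A := gen_choiceMixin (cinf_car A).
HB.instance Definition _ A := GRing.isZmodule.Build (cinf_car A)
  (@cinf_addA A) (@cinf_addC A) (@cinf_add0 A) (@cinf_addN A).
HB.instance Definition _ A := GRing.Zmodule_isComPzRing.Build (cinf_car A)
  (@cinf_mulA A) (@cinf_mulC A) (@cinf_mul1 A) (@cinf_mulDl A).

Definition cinf_underlying (A : cinf_ring_category R) : comPzRingType :=
  cinf_car A.

Section Morphisms.
Variables (A B : cinf_ring_category R) (s : hom A B).

Definition cinf_map (x : cinf_car A) : cinf_car B := ntapp s 1%N x.

Lemma ntapp_fmap (n m : E) (f : hom n m) (t : fobj (sval A) n) :
  ntapp s m (fmap (sval A) f t) = fmap (sval B) f (ntapp s n t).
Proof. exact: (congr1 (fun k : fobj (sval A) n -> fobj (sval B) m => k t)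
  (nt_natural s f)). Qed.

Lemma ntapp_pair (n m : nat) (x : fobj (sval A) n) (y : fobj (sval A) m) :
  ntapp s (n + m)%N (cinf_pair x y) = cinf_pair (ntapp s n x) (ntapp s m y).
Proof.
apply/esym/cinf_pairP; rewrite -ntapp_fmap.
  by rewrite cinf_fst_pair.
by rewrite cinf_snd_pair.
Qed.

Lemma cinf_map_zmod : zmod_morphism cinf_map.
Proof.
move=> x y; rewrite /cinf_map -[x - y]/(cinf_add x (cinf_opp y)).
by rewrite /cinf_add ntapp_fmap ntapp_pair /cinf_opp ntapp_fmap.
Qed.

Lemma cinf_map_monoid : monoid_morphism cinf_map.
Proof.
split.
  rewrite /cinf_map -[1]/(cinf_one A) /cinf_one ntapp_fmap.
  by congr (fmap (sval B) _ _); exact/esym/cinf_ptP.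
move=> x y; rewrite /cinf_map -[x * y]/(cinf_mul x y).
by rewrite /cinf_mul ntapp_fmap ntapp_pair.
Qed.

HB.instance Definition _ :=
  GRing.isZmodMorphism.Build (cinf_car A) (cinf_car B) cinf_map cinf_map_zmod.
HB.instance Definition _ :=
  GRing.isMonoidMorphism.Build (cinf_car A) (cinf_car B) cinf_map
    cinf_map_monoid.

Definition cinf_underlying_map :
  {rmorphism cinf_underlying A -> cinf_underlying B} := cinf_map.
End Morphisms.
End UnderlyingRing.

Lemma rmorphism_ext (S T : comPzRingType) (f g : {rmorphism S -> T}) :
  f =1 g -> f = g.
Proof.
case: f g => [f [[fa] [fm]]] [g [[ga] [gm]]] /= /funext fg.
case: _ / fg ga gm => ga gm.
by rewrite (Prop_irrelevance fa ga) (Prop_irrelevance fm gm).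
Qed.

Definition cring_id (S : comPzRingType) : {rmorphism S -> S} := idfun.

Definition cring_comp (S T U : comPzRingType) (g : {rmorphism T -> U})
  (f : {rmorphism S -> T}) : {rmorphism S -> U} := g \o f.

Lemma cring_compA (S T U V : comPzRingType) (h : {rmorphism U -> V})
    (g : {rmorphism T -> U}) (f : {rmorphism S -> T}) :
  cring_comp h (cring_comp g f) = cring_comp (cring_comp h g) f.
Proof. exact: rmorphism_ext. Qed.

Lemma cring_comp1 (S T : comPzRingType) (f : {rmorphism S -> T}) :
  cring_comp (cring_id T) f = f.
Proof. exact: rmorphism_ext. Qed.

Lemma cring_1comp (S T : comPzRingType) (f : {rmorphism S -> T}) :
  cring_comp f (cring_id S) = f.
Proof. exact: rmorphism_ext. Qed.

(* comPzRingType, unlike comNzRingType, includes the zero ring. *)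
Definition cring_category : category :=
  @Category comPzRingType (fun S T => {rmorphism S -> T}) cring_id cring_comp
    cring_compA cring_comp1 cring_1comp.

Section UnderlyingFunctor.
Variable R : realType.

Lemma underlying_id (A : cinf_ring_category R) :
  cinf_underlying_map (idc A) = cring_id (cinf_underlying A).
Proof. exact: rmorphism_ext. Qed.

Lemma underlying_comp (A B D : cinf_ring_category R) (g : hom B D)
    (f : hom A B) :
  cinf_underlying_map (g ∘ f) =
  cring_comp (cinf_underlying_map g) (cinf_underlying_map f).
Proof. exact: rmorphism_ext. Qed.

Definition underlying_ring : functor (cinf_ring_category R) cring_category :=
  @Functor (cinf_ring_category R) cring_category (@cinf_underlying R)
    (@cinf_underlying_map R) underlying_id underlying_comp.
End UnderlyingFunctor.

Section CringPullback.
Variables (S T U : comPzRingType) (f : {rmorphism S -> U})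
  (g : {rmorphism T -> U}).

Definition cring_pb_pred : {pred S * T} := fun x => f x.1 == g x.2.

Lemma cring_pb_closed : subring_closed cring_pb_pred.
Proof.
split; first by rewrite unfold_in /= !rmorph1.
  move=> x y; rewrite !unfold_in /= => /eqP fx /eqP fy.
  by rewrite !rmorphB fx fy.
move=> x y; rewrite !unfold_in /= => /eqP fx /eqP fy.
by rewrite !rmorphM fx fy.
Qed.

Record cring_pb := CringPb {
  cring_pb_val : S * T;
  cring_pb_valP : cring_pb_val \in cring_pb_pred }.

HB.instance Definition _ := [isSub for cring_pb_val].
HB.instance Definition _ := [Choice of cring_pb by <:].
HB.instance Definition _ :=
  GRing.SubChoice_isSubComPzRing.Build (S * T)%type cring_pb_pred cring_pb
    cring_pb_closed.

Definition cring_pb1 : {rmorphism cring_pb -> S} := fst \o val.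
Definition cring_pb2 : {rmorphism cring_pb -> T} := snd \o val.

Lemma cring_pb_comm : cring_comp f cring_pb1 = cring_comp g cring_pb2.
Proof. by apply: rmorphism_ext => x; apply/eqP; exact: (valP x). Qed.

Section Lift.
Variables (V : comPzRingType) (u : {rmorphism V -> S}) (v : {rmorphism V -> T})
  (e : cring_comp f u = cring_comp g v).

Lemma cring_pb_lift_subproof (x : V) : (u x, v x) \in cring_pb_pred.
Proof.
by rewrite unfold_in; apply/eqP; exact: (congr1 (fun h : {rmorphism _ -> _} => h x) e).
Qed.

Definition cring_pb_lift_fun (x : V) : cring_pb :=
  CringPb (cring_pb_lift_subproof x).

Lemma cring_pb_lift_zmod : zmod_morphism cring_pb_lift_fun.
Proof. by move=> x y; apply: val_inj; rewrite raddfB /= !rmorphB. Qed.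

Lemma cring_pb_lift_monoid : monoid_morphism cring_pb_lift_fun.
Proof.
split; first by apply: val_inj; rewrite rmorph1 /= !rmorph1.
by move=> x y; apply: val_inj; rewrite rmorphM /= !rmorphM.
Qed.

HB.instance Definition _ :=
  GRing.isZmodMorphism.Build V cring_pb cring_pb_lift_fun cring_pb_lift_zmod.
HB.instance Definition _ :=
  GRing.isMonoidMorphism.Build V cring_pb cring_pb_lift_fun
    cring_pb_lift_monoid.

Definition cring_pb_lift : {rmorphism V -> cring_pb} := cring_pb_lift_fun.

Lemma cring_pb1_lift : cring_comp cring_pb1 cring_pb_lift = u.
Proof. exact: rmorphism_ext. Qed.

Lemma cring_pb2_lift : cring_comp cring_pb2 cring_pb_lift = v.
Proof. exact: rmorphism_ext. Qed.
End Lift.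

Lemma cring_pb_uniq (V : comPzRingType) (h k : {rmorphism V -> cring_pb}) :
  cring_comp cring_pb1 h = cring_comp cring_pb1 k ->
  cring_comp cring_pb2 h = cring_comp cring_pb2 k -> h = k.
Proof.
move=> e1 e2; apply: rmorphism_ext => x; apply: val_inj.
apply: injective_projections.
  exact: (congr1 (fun h : {rmorphism _ -> _} => h x) e1).
exact: (congr1 (fun h : {rmorphism _ -> _} => h x) e2).
Qed.
End CringPullback.

Definition cring_pullbacks : pullbacks cring_category :=
  fun S T U f g => @Pullback cring_category S T U f g
    (cring_pb f g : comPzRingType)
    (cring_pb1 f g) (cring_pb2 f g) (cring_pb_comm f g)
    (@cring_pb_lift S T U f g) (@cring_pb1_lift S T U f g)
    (@cring_pb2_lift S T U f g) (@cring_pb_uniq S T U f g).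

Section CinfPullback.
Variable R : realType.
Local Notation E := (euclidean_category R).
Variables (A B D : cinf_ring_category R) (f : hom A D) (g : hom B D).

Definition cinf_pb_obj (n : E) : Type :=
  {x : fobj (sval A) n * fobj (sval B) n | ntapp f n x.1 = ntapp g n x.2}.

Lemma cinf_pb_map_subproof (n m : E) (h : hom n m) (x : cinf_pb_obj n) :
  ntapp f m (fmap (sval A) h (sval x).1) =
  ntapp g m (fmap (sval B) h (sval x).2).
Proof. by rewrite !ntapp_fmap (svalP x). Qed.

Definition cinf_pb_map (n m : E) (h : hom n m) (x : cinf_pb_obj n) :
    cinf_pb_obj m :=
  exist _ (fmap (sval A) h (sval x).1, fmap (sval B) h (sval x).2)
    (cinf_pb_map_subproof h x).

Lemma cinf_pb_ext (n : E) (x y : cinf_pb_obj n) :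
  (sval x).1 = (sval y).1 -> (sval x).2 = (sval y).2 -> x = y.
Proof.
by move=> e1 e2; apply: sval_inj; exact: injective_projections.
Qed.

Lemma cinf_pb_map_id (n : E) : cinf_pb_map (idc n) = fun x => x.
Proof. by apply/funext => x; apply: cinf_pb_ext; rewrite /= fmap_id. Qed.

Lemma cinf_pb_map_comp (n m p : E) (k : hom m p) (h : hom n m) :
  cinf_pb_map (k ∘ h) = fun x => cinf_pb_map k (cinf_pb_map h x).
Proof. by apply/funext => x; apply: cinf_pb_ext; rewrite /= fmap_comp. Qed.

Definition cinf_pb_functor : functor E set_category :=
  @Functor E set_category cinf_pb_obj cinf_pb_map cinf_pb_map_id
    cinf_pb_map_comp.

Lemma cinf_pb_product_preserving : product_preserving cinf_pb_functor.
Proof.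
split=> [n nt|n m p p1 p2 pP]; last first.
  have /set_productP HA := (svalP A).2 _ _ _ _ _ pP.
  have /set_productP HB := (svalP B).2 _ _ _ _ _ pP.
  have /set_productP HD := (svalP D).2 _ _ _ _ _ pP.
  apply/set_productP => x y.
  have [a [[a1 a2] au]] := HA (sval x).1 (sval y).1.
  have [b [[b1 b2] bu]] := HB (sval x).2 (sval y).2.
  have e : ntapp f p a = ntapp g p b.
    have [d [_ du]] := HD (ntapp f n (sval x).1) (ntapp f m (sval y).1).
    rewrite -(du (ntapp f p a)); last by rewrite -!ntapp_fmap a1 a2.
    by apply: du; rewrite -!ntapp_fmap b1 b2 (svalP x) (svalP y).
  exists (exist _ (a, b) e); split.
    by split; apply: cinf_pb_ext.
  by move=> z [zx zy]; apply: cinf_pb_ext; [apply: au|apply: bu];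
    rewrite -zx -zy.
have /set_terminalP[a aP] := (svalP A).1 _ nt.
have /set_terminalP[b bP] := (svalP B).1 _ nt.
have /set_terminalP[d dP] := (svalP D).1 _ nt.
have e : ntapp f n a = ntapp g n b by rewrite -(dP (ntapp f n a)).
apply/set_terminalP; exists (exist _ (a, b) e) => y.
by apply: cinf_pb_ext; [exact: aP|exact: bP].
Qed.

Definition cinf_pb : cinf_ring_category R :=
  exist _ cinf_pb_functor cinf_pb_product_preserving.

Definition cinf_pb1 : hom cinf_pb A :=
  @NatTrans E set_category cinf_pb_functor (sval A)
    (fun n x => (sval x).1) (fun n m h => erefl).

Definition cinf_pb2 : hom cinf_pb B :=
  @NatTrans E set_category cinf_pb_functor (sval B)
    (fun n x => (sval x).2) (fun n m h => erefl).

Lemma cinf_pb_comm : f ∘ cinf_pb1 = g ∘ cinf_pb2.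
Proof.
apply: nattrans_ext => n; apply/funext => x; exact: (svalP x).
Qed.

Section Lift.
Variables (X : cinf_ring_category R) (u : hom X A) (v : hom X B)
  (e : f ∘ u = g ∘ v).

Lemma cinf_pb_lift_subproof (n : E) (x : fobj (sval X) n) :
  ntapp f n (ntapp u n x) = ntapp g n (ntapp v n x).
Proof.
exact: (congr1 (fun h : nattrans (sval X) (sval D) => ntapp h n x) e).
Qed.

Definition cinf_pb_lift_fun (n : E) (x : fobj (sval X) n) : cinf_pb_obj n :=
  exist _ (ntapp u n x, ntapp v n x) (cinf_pb_lift_subproof x).

Lemma cinf_pb_lift_natural (n m : E) (h : hom n m) :
  (fun x => cinf_pb_lift_fun (fmap (sval X) h x)) =
  (fun x => cinf_pb_map h (cinf_pb_lift_fun x)).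
Proof.
by apply/funext => x; apply: cinf_pb_ext; rewrite /= ntapp_fmap.
Qed.

Definition cinf_pb_lift : hom X cinf_pb :=
  @NatTrans E set_category (sval X) cinf_pb_functor cinf_pb_lift_fun
    cinf_pb_lift_natural.

Lemma cinf_pb1_lift : cinf_pb1 ∘ cinf_pb_lift = u.
Proof. exact: nattrans_ext. Qed.

Lemma cinf_pb2_lift : cinf_pb2 ∘ cinf_pb_lift = v.
Proof. exact: nattrans_ext. Qed.
End Lift.

Lemma cinf_pb_uniq (X : cinf_ring_category R) (h k : hom X cinf_pb) :
  cinf_pb1 ∘ h = cinf_pb1 ∘ k -> cinf_pb2 ∘ h = cinf_pb2 ∘ k -> h = k.
Proof.
move=> e1 e2; apply: nattrans_ext => n; apply/funext => x.
apply: cinf_pb_ext.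
  exact: (congr1 (fun h : nattrans (sval X) (sval A) => ntapp h n x) e1).
exact: (congr1 (fun h : nattrans (sval X) (sval B) => ntapp h n x) e2).
Qed.
End CinfPullback.

Definition cinf_pullbacks (R : realType) : pullbacks (cinf_ring_category R) :=
  fun A B D f g => @Pullback (cinf_ring_category R) A B D f g (cinf_pb f g)
    (cinf_pb1 f g) (cinf_pb2 f g) (cinf_pb_comm f g)
    (@cinf_pb_lift R A B D f g) (@cinf_pb1_lift R A B D f g)
    (@cinf_pb2_lift R A B D f g) (@cinf_pb_uniq R A B D f g).

Arguments cinf_pullbacks : clear implicits.

(* Main.v *)
From HB Require Import structures.
From mathcomp Require Import all_boot all_order all_algebra.
From mathcomp Require Import boolp classical_sets functions reals topology.
From mathcomp Require Import normedtype landau derive.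
From mathcomp Require Import constructive_ereal measure lebesgue_measure.
From mathcomp Require Import lebesgue_integral ftc.
From mathcomp Require Import ring.
Require Import Defs.

(** For a commutative ring [B], an abelian group object [Y -> B] over [B] is the
same thing as a split square-zero extension: a surjection [p] with a section [s]
whose kernel has zero product. The section is the zero of the group; the kernel
squares to zero because [add] is a ring map on the fibre square and
[m * m' = add (m, 0) * add (0, m') = add ((m, 0) * (0, m')) = 0]; and for the
same reason the addition is forced to be [y + y' - s (p y)]. Hence a ring map
between two such objects over a map of base rings is additive as soon as it
commutes with the projections and the sections. These arguments only see
underlying rings, so they also apply to the abelian group objects over a
C^oo-ring [A] ([tangent_square_zero], [umap_tadd], [tangent_hom_of_umap]).

What relates the two sides is that the C^oo-structure of a split square-zero
extension [X -> A] is determined by that of [A] and by the ring [X]. By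
Hadamard's lemma, [h v - h u] is a sum of terms [(v_i - u_i) * g_i (u, v)] with
[g_i] smooth and [g_i (u, u)] the i-th partial derivative of [h]. At [u = s a]
and [v = x], where [a = p x], the factors [x_i - s a_i] lie in the kernel, and
multiplication by them depends only on the image in [A] of the other factor;
this leaves the first-order formula ([taylor])

   [h x = s (h a) + sum_i (x_i - s a_i) * s ((d_i h) a)].

Consequently a ring map between such extensions which commutes with projections
and sections commutes with all smooth operations ([cinf_lift]), and the functor
sending an abelian group object [X -> A] to [A] together with the underlying
extension of rings is full and faithful. It is essentially surjective because
the same formula, read as a definition ([jet]), makes any split square-zero
extension of the underlying ring of [A] into a C^oo-ring over [A]
([ext_ring]): functoriality is the chain rule, and Leibniz' rule says that the
ring operations so obtained are the given ones. *)

Set Implicit Arguments.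
Unset Strict Implicit.
Unset Printing Implicit Defensive.

Import Order.TTheory GRing.Theory Num.Theory numFieldNormedType.Exports.
Local Open Scope ring_scope.
Local Open Scope classical_set_scope.

(** * Hadamard's lemma *)

Section Calculus.
Variable R : realType.

Lemma is_derive_line (n : nat) (f : 'rV[R]_n -> R) (x d : 'rV[R]_n) (t : R) :
  (forall y, differentiable f y) ->
  is_derive t 1 (fun t => f (x + t *: d)) ('D_d f (x + t *: d)).
Proof.
move=> df.
have dl : is_diff t (fun t : R => x + t *: d) (fun t : R => t *: d).
  apply: (is_diff_eq (is_diffD (is_diff_cst x t) (is_diff_scalel t d))).
  by apply/funext => u; rewrite fctE add0r.
have dc : differentiable (fun t : R => f (x + t *: d)) t.
  exact: (@differentiable_comp _ _ _ _ (fun t : R => x + t *: d) f).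
apply: DeriveDef; first exact: diff_derivable.
rewrite deriveE// (@diff_comp _ _ _ _ (fun t : R => x + t *: d) f)//=.
by rewrite (@diff_val _ _ _ _ _ _ _ dl) scale1r deriveE.
Qed.

Lemma continuous_line (n : nat) (f : 'rV[R]_n -> R) (x d : 'rV[R]_n) :
  continuous f -> continuous (fun t : R => f (x + t *: d)).
Proof.
move=> cf t; apply: (@continuous_comp _ _ _ (fun t : R => x + t *: d) f).
  apply: (@cvgD _ _ _ _ _ (fun=> x) (fun t : R => t *: d)).
    exact: cvg_cst.
  exact: scalel_continuous.
exact: cf.
Qed.

Lemma differentiable_estimate (V W : normedModType R) (f : V -> W)
    (L : {linear V -> W}) (z : V) : continuous L ->
  (forall e, 0 < e -> \forall v \near nbhs (0 : V),
    `|f (v + z) - f z - L v| <= e * `|v|) ->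
  differentiable f z /\ 'd f z = L :> (V -> W).
Proof.
move=> Lc est; have LE : f \o shift z = cst (f z) + L +o_ 0 id.
  apply/eqaddoP => e e0; apply: filterS (est e e0) => v /=.
  by rewrite opprD addrA.
have dE := diff_unique Lc LE; split=> //.
by apply/diff_locallyP; rewrite dE.
Qed.

Lemma derive_coord (n : nat) (W : normedModType R) (f : 'rV[R]_n -> W)
    (v x : 'rV[R]_n) : differentiable f x ->
  'D_v f x = \sum_j v 0 j *: 'D_(delta_mx 0 j) f x.
Proof.
move=> df; rewrite deriveE// {1}[v]row_sum_delta linear_sum.
by apply: eq_bigr => j _; rewrite linearZ/= deriveE.
Qed.

Section ParametricIntegral.
Variable n : nat.
Local Notation mu := (@lebesgue_measure R).
Implicit Types (Phi : 'rV[R]_(1 + n) -> R) (z v : 'rV[R]_n).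

(** The extra leading coordinate is the variable of integration. *)
Definition with_time (s : R) z : 'rV[R]_(1 + n) := row_mx (const_mx s) z.

(** Keeping all variables in one row vector lets [Ck] speak about [Phi] jointly
in [s] and [z]. *)
Definition mean Phi z : R := \int[mu]_(s in `[0, 1]) Phi (with_time s z).

Lemma with_timeE s z :
  with_time s z = s *: with_time 1 0 + with_time 0 z.
Proof.
by rewrite /with_time scale_row_mx add_row_mx scaler0 add0r; congr row_mx;
  apply/rowP => j; rewrite !mxE mulr1 addr0.
Qed.

Lemma with_timeD s z v :
  with_time s (z + v) = with_time s z + with_time 0 v.
Proof.
by rewrite /with_time add_row_mx; congr row_mx; apply/rowP => j;
  rewrite !mxE addr0.
Qed.

Lemma with_timeZ a v : with_time 0 (a *: v) = a *: with_time 0 v.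
Proof.
by rewrite /with_time scale_row_mx; congr row_mx; apply/rowP => j;
  rewrite !mxE mulr0.
Qed.

Lemma with_time_continuous :
  continuous (fun sz : R * 'rV[R]_n => with_time sz.1 sz.2).
Proof.
have c0 : continuous (with_time 0).
  have := smooth_row_mx (fun k => @Ck_cst R n _ (const_mx 0 : 'rV[R]_1) k)
    (@smooth_id R n).
  by move=> /(_ 0%N); exact.
rewrite (_ : (fun _ => _) = (fun sz : R * 'rV[R]_n =>
  sz.1 *: with_time 1 0 + with_time 0 sz.2)); last first.
  by apply/funext => sz; rewrite with_timeE.
move=> [s z]; apply: cvgD.
  by apply: cvgZr_tmp; exact: cvg_fst.
apply: (@cvg_comp _ _ _ snd (with_time 0)); last exact: c0.
exact: cvg_snd.
Qed.

(** Compactness of [[0, 1]] makes the continuity in [z] uniform in [s]. *)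
Lemma near_uniform_time Phi z (e : R) : continuous Phi -> 0 < e ->
  \forall z' \near z, forall s, s \in `[0, 1]%R ->
    `|Phi (with_time s z') - Phi (with_time s z)| < e.
Proof.
move=> cPhi e0.
have cPsi (y : R * 'rV[R]_n) :
    (Phi \o (fun sz : R * 'rV[R]_n => with_time sz.1 sz.2)) @ y -->
    Phi (with_time y.1 y.2).
  apply: continuous_comp; first exact: with_time_continuous.
  exact: cPhi.
have e20 : 0 < e / 2 by rewrite divr_gt0.
have /compact_near_coveringP cov := @segment_compact R 0 1.
pose P z' s : Prop := `|Phi (with_time s z') - Phi (with_time s z)| < e.
have {cov} : (forall s : R, `[0, 1]%classic s ->
    \forall s' \near s & z' \near z, P z' s') ->
  \forall z' \near z, `[0, 1]%classic `<=` P z'.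
  exact: cov _ (nbhs z) P (nbhs_filter z).
move=> cov; suff H : forall s : R, `[0, 1]%classic s ->
    \forall s' \near s & z' \near z, P z' s'.
  by apply: filterS (cov H) => z' zP s; exact: zP.
move=> {cov} s _.
have /cvgrPdist_lt/(_ _ e20) := cPsi (s, z).
move=> [[U V] /= [Us Vz] UV]; exists (U, V) => //= -[s' z'] /= [Us' Vz'].
have /= h1 := UV (s', z') (conj Us' Vz').
have /= h2 := UV (s', z) (conj Us' (nbhs_singleton Vz)).
rewrite /P distrC (splitr e).
rewrite (le_lt_trans (ler_distD (Phi (with_time s z)) _ _))//.
by rewrite ltrD// distrC.
Qed.

Lemma integrable_time Phi z : continuous Phi ->
  mu.-integrable `[0, 1] (EFin \o (fun s => Phi (with_time s z))).
Proof.
move=> cPhi; apply: continuous_compact_integrable; first exact: segment_compact.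
apply: continuous_subspaceT => s.
apply: (@continuous_comp _ _ _ (fun s => with_time s z) Phi); last exact: cPhi.
rewrite (_ : (fun s => _) = (fun s => s *: with_time 1 0 + with_time 0 z)).
  apply: (@cvgD _ _ _ _ _ (fun s : R => s *: with_time 1 0)
    (fun=> with_time 0 z)); last exact: cvg_cst.
  exact: scalel_continuous.
by apply/funext => t; rewrite with_timeE.
Qed.

Lemma integrable_unitB (f g : R -> R) :
  mu.-integrable `[0, 1] (EFin \o f) -> mu.-integrable `[0, 1] (EFin \o g) ->
  mu.-integrable `[0, 1] (EFin \o (fun s => f s - g s)).
Proof. by move=> fi gi; have := integrableB _ fi gi; apply. Qed.

Lemma normr_unit_integral_le (f : R -> R) (e : R) :
  mu.-integrable `[0, 1] (EFin \o f) ->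
  (forall s, s \in `[0, 1]%R -> `|f s| <= e) ->
  `|\int[mu]_(s in `[0, 1]) f s| <= e.
Proof.
move=> fi fe; apply: le_trans (le_normr_Rintegral _ fi) _ => //.
have -> : e = \int[mu]_(s in `[0, 1]) e.
  rewrite Rintegral_cst//= lebesgue_measure_itv/= lte_fin ltr01.
  by rewrite -EFinB subr0 mulr1.
apply: le_Rintegral => //.
- exact: integrable_norm.
- apply: continuous_compact_integrable; first exact: segment_compact.
  by apply: continuous_subspaceT => s; exact: cvg_cst.
Qed.

Lemma unit_integral_sum (I : Type) (r : seq I) (a : I -> R) (f : I -> R -> R) :
  (forall i, mu.-integrable `[0, 1] (EFin \o f i)) ->
  \int[mu]_(s in `[0, 1]) (\sum_(i <- r) a i * f i s) =
  \sum_(i <- r) a i * \int[mu]_(s in `[0, 1]) f i s.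
Proof.
move=> fi; have afi i : mu.-integrable `[0, 1] (EFin \o (fun s => a i * f i s)).
  exact: (integrableZl _ (a i) (fi i)).
suff [] : mu.-integrable `[0, 1] (EFin \o fun s => \sum_(i <- r) a i * f i s) /\
  \int[mu]_(s in `[0, 1]) (\sum_(i <- r) a i * f i s) =
  \sum_(i <- r) a i * \int[mu]_(s in `[0, 1]) f i s by [].
elim: r => [|i r [IHi IH]].
  have -> : (fun s => \sum_(i <- [::]) a i * f i s) = (fun=> 0).
    by apply/funext => s; rewrite big_nil.
  rewrite big_nil Rintegral_cst//= mul0r; split=> //.
  exact: integrable0.
have -> : (fun s => \sum_(i <- i :: r) a i * f i s) =
    (fun s => a i * f i s + \sum_(i <- r) a i * f i s).
  by apply/funext => s; rewrite big_cons.
split; first by have := integrableD _ (afi i) IHi; apply.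
by rewrite RintegralD//= IH big_cons RintegralZl.
Qed.

Lemma mean_continuous Phi : continuous Phi -> continuous (mean Phi).
Proof.
move=> cPhi z; apply/(@cvgrPdist_le _ _ _ (nbhs z)) => e e0.
near=> z'; have h : forall s, s \in `[0, 1]%R ->
    `|Phi (with_time s z') - Phi (with_time s z)| < e.
  by near: z'; exact: near_uniform_time.
rewrite distrC /mean -RintegralB//; try exact: integrable_time.
apply: normr_unit_integral_le => [|s ss]; last exact/ltW/h.
by apply: integrable_unitB; exact: integrable_time.
Unshelve. all: by end_near. Qed.

Lemma derive_space Phi v y : (forall y, differentiable Phi y) ->
  'D_(with_time 0 v) Phi y =
  \sum_j v 0 j * 'D_(with_time 0 (delta_mx 0 j)) Phi y.
Proof.
move=> dPhi; rewrite deriveE// {1}[v]row_sum_delta.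
have -> : with_time 0 (\sum_j v 0 j *: delta_mx 0 j) =
          \sum_j v 0 j *: with_time 0 (delta_mx 0 j).
  elim: (index_enum _) => [|j r IH].
    by rewrite !big_nil; exact: row_mx0.
  by rewrite !big_cons with_timeD with_timeZ IH.
rewrite linear_sum; apply: eq_bigr => j _.
by rewrite linearZ/= deriveE.
Qed.

(** The first-order expansion of [Phi (s, -)] holds with an error uniform in [s],
by the mean value theorem and [near_uniform_time] for the partial derivatives;
integrating it gives the expansion of the mean. *)
Lemma mean_taylor1 Phi z : Ck 1 Phi ->
  forall e, 0 < e -> \forall v \near nbhs (0 : 'rV[R]_n),
  `|mean Phi (v + z) - mean Phi z - mean ('D_(with_time 0 v) Phi) z| <=
    e * `|v|.
Proof.
move=> [dPhi cD] e e0.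
pose d (j : 'I_n) := 'D_(with_time 0 (delta_mx 0 j)) Phi.
have cPhi : continuous Phi by move=> y; exact: differentiable_continuous.
(* The error is a sum of n terms; n.+1 only avoids a division by zero. *)
pose e' := e / n.+1%:R.
have e'0 : 0 < e' by rewrite divr_gt0// ltr0n.
have [dl dl0 hdl] : exists2 dl : R, 0 < dl & forall z', `|z - z'| < dl ->
    forall j s, s \in `[0, 1]%R ->
    `|d j (with_time s z') - d j (with_time s z)| < e'.
  have : \forall z' \near nbhs z, forall j s, s \in `[0, 1]%R ->
    `|d j (with_time s z') - d j (with_time s z)| < e'.
    by apply: filter_forall => j; apply: near_uniform_time => //; exact: cD.
  by move=> /nbhs_normP[dl dl0 H]; exists dl => // z' zz'; exact: H.
have small : \forall v \near nbhs (0 : 'rV[R]_n), `|v| < dl.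
  apply: (nbhs_normP (0 : 'rV[R]_n) (fun v => `|v| < dl)).2.
  by exists dl => //= y; rewrite /= sub0r normrN.
near=> v'.
have v'dl : `|v'| < dl by near: v'.
have h (t s : R) j : t \in `[0, 1]%R -> s \in `[0, 1]%R ->
    `|d j (with_time s (z + t *: v')) - d j (with_time s z)| <= e'.
  rewrite in_itv/= => /andP[t0 t1] ss; apply/ltW/hdl => //.
  rewrite opprD addNKr normrN normrZ ger0_norm//.
  by apply: le_lt_trans v'dl; rewrite ler_piMl.
rewrite /mean -!RintegralB//; try exact: integrable_time; last first.
- exact: (integrable_time (Phi := 'D_(with_time 0 v') Phi) z (cD _)).
- by apply: integrable_unitB; exact: integrable_time.
apply: normr_unit_integral_le => [|s ss].
  apply: integrable_unitB; last first.
    exact: (integrable_time (Phi := 'D_(with_time 0 v') Phi) z (cD _)).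
  by apply: integrable_unitB; exact: integrable_time.
have [t t01 ->] : exists2 t, t \in `[0, 1]%R &
  Phi (with_time s (v' + z)) - Phi (with_time s z) =
  'D_(with_time 0 v') Phi (with_time s (z + t *: v')).
  have [|t _||t t01 E] := @MVT_segment R
      (fun t => Phi (with_time s z + t *: with_time 0 v'))
      (fun t => 'D_(with_time 0 v') Phi (with_time s z + t *: with_time 0 v'))
      0 1.
  - exact: ler01.
  - exact: is_derive_line.
  - exact/continuous_subspaceT/continuous_line.
  - exists t => //; rewrite (with_timeD _ z (t *: v')) with_timeZ.
    move: E; rewrite scale1r scale0r addr0 subr0 mulr1 => <-.
    by rewrite [v' + z]addrC with_timeD.
rewrite !derive_space// -sumrB.
apply: le_trans (ler_norm_sum _ _ _) _.
apply: (@le_trans _ _ (\sum_(j < n) e' * `|v'|)).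
  apply: ler_sum => j _; rewrite -mulrBr normrM mulrC.
  apply: ler_pM => //; first exact: h.
  rewrite -[`|v'|]/(mx_norm v') mx_normrE.
  exact: (le_bigmax _ (fun ij => `|v' ij.1 ij.2|) (0, j)).
rewrite sumr_const card_ord -mulrnAl ler_wpM2r// /e' -mulr_natr.
by rewrite -mulrA ler_piMr ?(ltW e0)// mulrC ler_pdivrMr// ?mul1r ler_nat.
Unshelve. all: by end_near. Qed.

Lemma mean_differential Phi z : Ck 1 Phi ->
  differentiable (mean Phi) z /\
  forall v, 'D_v (mean Phi) z = mean ('D_(with_time 0 v) Phi) z.
Proof.
move=> CPhi; have [dPhi cD] := CPhi.
pose c j := mean ('D_(with_time 0 (delta_mx 0 j)) Phi) z.
have meanE v : mean ('D_(with_time 0 v) Phi) z = \sum_j v 0 j * c j.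
  rewrite /mean; under eq_Rintegral do rewrite derive_space//.
  rewrite unit_integral_sum// => j.
  exact: (integrable_time (Phi := 'D_(with_time 0 (delta_mx 0 j)) Phi) z
    (cD _)).
pose L v := \sum_j v 0 j * c j.
have Llin : linear L.
  move=> a u v; rewrite /L -[a *: (\sum_j _)]/(a * _) mulr_sumr -big_split.
  by apply: eq_bigr => j _; rewrite !mxE mulrDl mulrA.
pose lL := GRing.isLinear.Build _ _ _ _ _ Llin.
pose LL : {linear 'rV[R]_n -> R} := HB.pack L lL.
have Lc : continuous LL.
  apply: (@Ck_continuous R n R 0); apply: Ck_sum => j; apply: Ck_mul.
    exact: Ck_coord.
  exact: Ck_cst.
have est e : 0 < e -> \forall v \near nbhs (0 : 'rV[R]_n),
    `|mean Phi (v + z) - mean Phi z - LL v| <= e * `|v|.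
  move=> /(mean_taylor1 z CPhi); apply: filterS => v.
  by rewrite meanE.
have [dm dE] := differentiable_estimate Lc est.
by split=> // v; rewrite meanE deriveE// dE.
Qed.

Lemma mean_Ck Phi k : Ck k Phi -> Ck k (mean Phi).
Proof.
elim: k Phi => [|k IH] Phi; first exact: mean_continuous.
move=> CPhi; have C1 : Ck 1 Phi.
  by case: CPhi => dPhi cD; split=> // v; exact/Ck_continuous/cD.
split=> [z|v]; first by have [] := mean_differential z C1.
rewrite (_ : 'D_v _ = mean ('D_(with_time 0 v) Phi)); first exact/IH/CPhi.2.
by apply/funext => z; have [_ ->] := mean_differential z C1.
Qed.

End ParametricIntegral.

Lemma Ck_comp_scalar n m k (g : 'rV[R]_m -> R) (f : 'rV[R]_n -> 'rV[R]_m) :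
  Ck k g -> Ck k f -> Ck k (fun x => g (f x)).
Proof.
move=> gk fk.
have grow : Ck k (fun x => const_mx (g x) : 'rV[R]_1).
  apply: Ck_row => j; rewrite (_ : (fun x => _) = g)//.
  by apply/funext => x; rewrite mxE.
have := Ck_entry 0 (Ck_comp grow fk).
rewrite (_ : (fun x => _) = (fun x => g (f x)))//.
by apply/funext => x; rewrite mxE.
Qed.

Lemma Ck_opp n k (f : 'rV[R]_n -> R) : Ck k f -> Ck k (fun x => - f x).
Proof.
move=> fk; rewrite (_ : (fun x => _) = (fun x => -1 * f x)); last first.
  by apply/funext => x; rewrite mulN1r.
by apply: Ck_mul => //; exact: Ck_cst.
Qed.

(** Integrate the derivative of [h] along the segment from [u] to [v]: [g i] at
[(u, v)] is the mean of the i-th partial derivative of [h] over that segment. *)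
Lemma hadamard n (h : 'rV[R]_n -> R) : (forall k, Ck k h) ->
  exists g : 'I_n -> 'rV[R]_(n + n) -> R,
  [/\ forall i k, Ck k (g i),
      forall u v, h v - h u = \sum_i (v 0 i - u 0 i) * g i (row_mx u v) &
      forall i u, g i (row_mx u u) = 'D_(delta_mx 0 i) h u].
Proof.
move=> hs.
pose segment (x : 'rV[R]_(1 + (n + n))) : 'rV[R]_n :=
  \row_j (x 0 (rshift 1 (lshift n j)) + x 0 (lshift (n + n) ord0) *
    (x 0 (rshift 1 (rshift n j)) - x 0 (rshift 1 (lshift n j)))).
have segmentE s u v : segment (with_time s (row_mx u v)) = u + s *: (v - u).
  apply/rowP => j; rewrite mxE /with_time !row_mxEr !row_mxEl.
  by rewrite !mxE.
have segment_smooth k : Ck k segment.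
  apply: Ck_row => j.
  rewrite (_ : (fun x => _) = (fun x : 'rV[R]_(1 + (n + n)) =>
    x 0 (rshift 1 (lshift n j)) + x 0 (lshift (n + n) ord0) *
    (x 0 (rshift 1 (rshift n j)) - x 0 (rshift 1 (lshift n j))))).
    apply: Ck_add; first exact: Ck_coord.
    apply: Ck_mul; first exact: Ck_coord.
    by apply: Ck_add; [exact: Ck_coord|apply: Ck_opp; exact: Ck_coord].
  by apply/funext => x; rewrite mxE.
pose d i := 'D_(delta_mx 0 i) h.
have d_smooth i k : Ck k (fun x => d i (segment x)).
  apply: Ck_comp_scalar; last exact: segment_smooth.
  exact: (hs k.+1).2.
have dh x : differentiable h x := (hs 1%N).1 x.
exists (fun i => mean (fun x => d i (segment x))); split.
- by move=> i k; exact: mean_Ck.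
- move=> u v; have hline s : 'D_(v - u) h (u + s *: (v - u)) =
      \sum_i (v 0 i - u 0 i) * d i (segment (with_time s (row_mx u v))).
    rewrite derive_coord//.
    by apply: eq_bigr => i _; rewrite !mxE segmentE.
  rewrite -unit_integral_sum; last first.
    move=> i; apply: (integrable_time (Phi := fun x => d i (segment x))).
    exact: (d_smooth i 0%N).
  rewrite /Rintegral (@continuous_FTC2 _ _ (fun t => h (u + t *: (v - u)))).
  + by rewrite scale1r scale0r addr0 subrKC.
  + exact: ltr01.
  + rewrite (_ : (fun s => _) = (fun s => 'D_(v - u) h (u + s *: (v - u)))).
      apply: continuous_subspaceT.
      exact: (@continuous_line n ('D_(v - u) h) u (v - u) ((hs 1%N).2 _)).
    by apply/funext => s; rewrite hline.
  + split.
    * move=> t _.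
      exact: (@ex_derive _ _ _ _ _ _ _ (is_derive_line u (v - u) t dh)).
    * exact/cvg_at_right_filter/(@continuous_line n h u (v - u) (hs 0%N)).
    * exact/cvg_at_left_filter/(@continuous_line n h u (v - u) (hs 0%N)).
  + move=> t _ /=; rewrite derive1E -hline.
    exact: (@derive_val _ _ _ _ _ _ _ (is_derive_line u (v - u) t dh)).
- move=> i u; rewrite /mean.
  under eq_Rintegral do rewrite segmentE subrr scaler0 addr0.
  rewrite Rintegral_cst//= lebesgue_measure_itv/= lte_fin ltr01.
  by rewrite -EFinB subr0 mulr1.
Qed.
End Calculus.

Local Close Scope classical_set_scope.
Local Open Scope cat_scope.

(** * Smooth functions on the elements of a C^oo-ring *)

Section Evaluation.
Variable R : realType.
Local Notation E := (euclidean_category R).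
Implicit Type A B : cinf_ring_category R.

Definition scalar_hom n (f : 'rV[R]_n -> R) (fs : forall k, Ck k f) :
  @hom E n 1%N.
Proof.
exists (fun x => const_mx (f x)) => k; apply: Ck_row => j.
by rewrite (_ : (fun x => _) = f)//; apply/funext => x; rewrite mxE.
Defined.

Definition eucl_coord n (i : 'I_n) : @hom E n 1%N :=
  scalar_hom (fun k => @Ck_coord R n i k).

Lemma smooth_partial n m (f : 'rV[R]_n -> 'rV[R]_m) (v : 'rV[R]_n) :
  smooth f -> smooth ('D_v f).
Proof. by move=> fs k; exact: (fs k.+1).2. Qed.

Definition eucl_partial n (h : @hom E n 1%N) (i : 'I_n) : @hom E n 1%N :=
  exist _ ('D_(delta_mx 0 i) (sval h)) (smooth_partial _ (svalP h)).

Lemma eucl_hom1_ext n (f g : @hom E n 1%N) :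
  (forall x, sval f x 0 0 = sval g x 0 0) -> f = g.
Proof.
by move=> fg; apply: eucl_hom_ext => x; apply/rowP => j; rewrite ord1 fg.
Qed.

(** The value [A(h)(a)], typed in the ring [A(R)] so that ring lemmas apply. *)
Definition ev A n (h : @hom E n 1%N) (a : fobj (sval A) n) :
    cinf_underlying A := fmap (sval A) h a.

Lemma ev_fmap A n m (h : @hom E m 1%N) (f : @hom E n m) (a : fobj (sval A) n) :
  ev h (fmap (sval A) f a) = ev (h ∘ f) a.
Proof. by rewrite /ev fmapE. Qed.

Lemma ev_nat A B (s : hom A B) n (h : @hom E n 1%N) (a : fobj (sval A) n) :
  cinf_underlying_map s (ev h a) = ev h (ntapp s n a).
Proof. exact: ntapp_fmap. Qed.

Lemma ev_coord1 A (x : cinf_underlying A) : ev (eucl_coord 0) x = x.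
Proof.
rewrite /ev (_ : eucl_coord 0 = idc (1%N : E)) ?fmap_id//.
by apply: eucl_hom1_ext => y; rewrite mxE.
Qed.

Lemma evD A n (h k l : @hom E n 1%N) (a : fobj (sval A) n) :
  (forall x, sval l x 0 0 = sval h x 0 0 + sval k x 0 0) ->
  ev l a = ev h a + ev k a.
Proof.
move=> lE; rewrite -[RHS]/(cinf_add _ _) cinf_add_fmap.
congr (fmap (sval A) _ a).
by apply: eucl_hom1_ext => x; rewrite lE /= row_mxKl row_mxKr mxE.
Qed.

Lemma evM A n (h k l : @hom E n 1%N) (a : fobj (sval A) n) :
  (forall x, sval l x 0 0 = sval h x 0 0 * sval k x 0 0) ->
  ev l a = ev h a * ev k a.
Proof.
move=> lE; rewrite -[RHS]/(cinf_mul _ _) cinf_mul_fmap.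
congr (fmap (sval A) _ a).
by apply: eucl_hom1_ext => x; rewrite lE /= mxE row_mxKl row_mxKr.
Qed.

Lemma ev0 A n (l : @hom E n 1%N) (a : fobj (sval A) n) :
  (forall x, sval l x 0 0 = 0) -> ev l a = 0.
Proof.
move=> l0; rewrite -[RHS]/(cinf_zero A) /cinf_zero (cinf_cst_fmap _ a).
by congr (fmap (sval A) _ a); apply: eucl_hom1_ext => x; rewrite l0 mxE.
Qed.

Lemma ev1 A n (l : @hom E n 1%N) (a : fobj (sval A) n) :
  (forall x, sval l x 0 0 = 1) -> ev l a = 1.
Proof.
move=> l0; rewrite -[RHS]/(cinf_one A) /cinf_one (cinf_cst_fmap _ a).
by congr (fmap (sval A) _ a); apply: eucl_hom1_ext => x; rewrite l0 mxE.
Qed.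

Lemma Ck_val n k (h : @hom E n 1%N) : Ck k (fun x => sval h x 0 0).
Proof. by apply: Ck_entry; exact: (svalP h k). Qed.

Lemma evB A n (h k l : @hom E n 1%N) (a : fobj (sval A) n) :
  (forall x, sval l x 0 0 = sval h x 0 0 - sval k x 0 0) ->
  ev l a = ev h a - ev k a.
Proof.
move=> lE; apply/eqP; rewrite eq_sym subr_eq; apply/eqP/evD => x.
by rewrite lE subrK.
Qed.

(** Stated with a given smooth [l], so that no smoothness has to be proved where
it is applied; the induction supplies the partial sums. *)
Lemma ev_sumM A n (I : Type) (r : seq I) (h k : I -> @hom E n 1%N)
    (l : @hom E n 1%N) (a : fobj (sval A) n) :
  (forall x, sval l x 0 0 =
     \sum_(i <- r) sval (h i) x 0 0 * sval (k i) x 0 0) ->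
  ev l a = \sum_(i <- r) ev (h i) a * ev (k i) a.
Proof.
elim: r l => [|i r IH] l lE.
  by rewrite big_nil; apply: ev0 => x; rewrite lE big_nil.
have ps j : forall d, Ck d (fun x => sval (h j) x 0 0 * sval (k j) x 0 0).
  by move=> d; apply: Ck_mul; exact: Ck_val.
have ss d : Ck d (fun x => \sum_(j <- r) sval (h j) x 0 0 * sval (k j) x 0 0).
  elim: r {IH lE} => [|j r IH].
    rewrite (_ : (fun x => _) = fun=> 0); first exact: Ck_cst.
    by apply/funext => x; rewrite big_nil.
  rewrite (_ : (fun x => _) = fun x => sval (h j) x 0 0 * sval (k j) x 0 0 +
    \sum_(j <- r) sval (h j) x 0 0 * sval (k j) x 0 0).
    by apply: Ck_add => //; exact: ps.
  by apply/funext => x; rewrite big_cons.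
rewrite big_cons -(IH (scalar_hom ss)); last by move=> x; rewrite mxE.
rewrite -(evM (h := h i) (k := k i) (l := scalar_hom (ps i))); last first.
  by move=> x; rewrite mxE.
by apply: evD => x; rewrite lE big_cons !mxE.
Qed.

Lemma eucl_coord_lshift n m (i : 'I_n) :
  eucl_coord (lshift m i) = eucl_coord i ∘ eucl_fst R n m.
Proof. by apply: eucl_hom1_ext => x; rewrite !mxE. Qed.

Lemma eucl_coord_rshift n m (i : 'I_m) :
  eucl_coord (rshift n i) = eucl_coord i ∘ eucl_snd R n m.
Proof. by apply: eucl_hom1_ext => x; rewrite !mxE. Qed.

Lemma ev_coord_pair A n m (x : fobj (sval A) n) (y : fobj (sval A) m) i :
  ev (eucl_coord i) (cinf_pair x y) =
  match fintype.split i with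
  | inl j => ev (eucl_coord j) x
  | inr j => ev (eucl_coord j) y
  end.
Proof.
case: splitP => j ij.
  rewrite (_ : i = lshift m j) ?eucl_coord_lshift; last exact: val_inj.
  by rewrite -ev_fmap cinf_fst_pair.
rewrite (_ : i = rshift n j) ?eucl_coord_rshift; last exact: val_inj.
by rewrite -ev_fmap cinf_snd_pair.
Qed.

Lemma cinf_pair_eta A n m (x : fobj (sval A) (n + m)%N) :
  cinf_pair (fmap (sval A) (eucl_fst R n m) x)
            (fmap (sval A) (eucl_snd R n m) x) = x.
Proof. exact: cinf_pairP. Qed.

(** With [cinf_tuple], this identifies [A(R^n)] with the n-th power of
[A(R)]. *)
Lemma cinf_coord_inj A n (x y : fobj (sval A) n) :
  (forall i, ev (eucl_coord i) x = ev (eucl_coord i) y) -> x = y.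
Proof.
elim: n x y => [|n IH] x y xy; first by rewrite -(cinf_ptP x) -(cinf_ptP y).
rewrite -(@cinf_pair_eta A 1 n x) -(@cinf_pair_eta A 1 n y).
congr (@cinf_pair R A 1%N n _ _).
  have := xy (lshift n (0 : 'I_1)).
  rewrite !(@eucl_coord_lshift 1 n) -!ev_fmap => e.
  by rewrite -[LHS](@ev_coord1 A) -[RHS](@ev_coord1 A).
apply: IH => i; have := xy (rshift 1 i).
by rewrite !(@eucl_coord_rshift 1 n) -!ev_fmap.
Qed.

Lemma cinf_tuple_ex A n (y : 'I_n -> cinf_underlying A) :
  exists x : fobj (sval A) n, forall i, ev (eucl_coord i) x = y i.
Proof.
elim: n y => [|n IH] y; first by exists (cinf_pt A) => -[].
have [x xy] := IH (fun i => y (rshift 1 i)).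
exists (@cinf_pair R A 1 n (y (lshift n (0 : 'I_1))) x) => i.
rewrite (@ev_coord_pair A 1 n); case: splitP => j ij.
  rewrite (ord1 j) ev_coord1; congr y; apply: val_inj.
  by rewrite /= ij (ord1 j).
by rewrite xy; congr y; exact: val_inj.
Qed.

Definition cinf_tuple A n (y : 'I_n -> cinf_underlying A) : fobj (sval A) n :=
  sval (cid (cinf_tuple_ex y)).

Lemma ev_coord_tuple A n (y : 'I_n -> cinf_underlying A) i :
  ev (eucl_coord i) (cinf_tuple y) = y i.
Proof. by rewrite /cinf_tuple; case: cid. Qed.

Lemma cinf_hom_ext A B (s t : hom A B) :
  cinf_underlying_map s =1 cinf_underlying_map t -> s = t.
Proof.
move=> st; apply: nattrans_ext => n; apply/funext => x.
by apply: cinf_coord_inj => i; rewrite -!ev_nat st.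
Qed.

End Evaluation.

(** * Split square-zero extensions *)

Section SquareZeroRing.
Variables (Y B : comPzRingType).
Variables (p : {rmorphism Y -> B}) (s : {rmorphism B -> Y}).

Definition square_zero : Prop :=
  cancel s p /\ forall y y', p y = 0 -> p y' = 0 -> y * y' = 0.

Hypothesis ps : square_zero.

(** The kernel is a module over the base: multiplication by [y] in the kernel
depends only on the image of the other factor. *)
Lemma square_zeroM y y' : p y = 0 -> y * y' = y * s (p y').
Proof.
move=> py; apply/subr0_eq; rewrite -mulrBr; apply: ps.2 => //.
by rewrite rmorphB ps.1 subrr.
Qed.

Lemma square_zero_sub y y' : (y - s (p y)) * (y' - s (p y')) = 0.
Proof. by apply: ps.2; rewrite rmorphB ps.1 subrr. Qed.

Section Neg.
Variables (W : comPzRingType) (f : {rmorphism W -> Y}).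

(** The inverse of [f x] in the group law with zero [s] on the fibres of [p]: in
terms of [b = p (f x)] and of the kernel it sends [s b + m] to [s b - m]. *)
Definition fiber_opp_fun (x : W) : Y := s (p (f x)) *+ 2 - f x.

Lemma fiber_opp_zmod : zmod_morphism fiber_opp_fun.
Proof. by move=> x y; rewrite /fiber_opp_fun !rmorphB /=; ring. Qed.

Lemma fiber_opp_monoid : monoid_morphism fiber_opp_fun.
Proof.
split; first by rewrite /fiber_opp_fun !rmorph1; ring.
move=> x y; have := square_zero_sub (f x) (f y).
rewrite /fiber_opp_fun !rmorphM /= => e; apply/eqP; rewrite -subr_eq0.
set a := f x in e *; set b := f y in e *.
set c := s _ in e *; set d := s _ in e *.
have -> : (c * d) *+ 2 - a * b - (c *+ 2 - a) * (d *+ 2 - b) =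
   - ((a - c) * (b - d)) *+ 2 by ring.
by rewrite e oppr0 mul0rn.
Qed.

HB.instance Definition _ :=
  GRing.isZmodMorphism.Build W Y fiber_opp_fun fiber_opp_zmod.
HB.instance Definition _ :=
  GRing.isMonoidMorphism.Build W Y fiber_opp_fun fiber_opp_monoid.

Definition fiber_opp : {rmorphism W -> Y} := fiber_opp_fun.
End Neg.

Section Add.
Variables (W : comPzRingType) (f g : {rmorphism W -> Y}).
Hypothesis fg : forall x, p (f x) = p (g x).

(** The sum of [f x] and [g x] in the same group law: it sends [s b + m] and
[s b + m'] to [s b + m + m']. *)
Definition fiber_add_fun (x : W) : Y := f x + g x - s (p (f x)).

Lemma fiber_add_zmod : zmod_morphism fiber_add_fun.
Proof. by move=> x y; rewrite /fiber_add_fun !rmorphB /=; ring. Qed.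

Lemma fiber_add_monoid : monoid_morphism fiber_add_fun.
Proof.
split; first by rewrite /fiber_add_fun !rmorph1 addrK.
move=> x y; have := square_zero_sub (f x) (g y).
have := square_zero_sub (g x) (f y); rewrite -!fg.
rewrite /fiber_add_fun !rmorphM /= => e1 e2; apply/eqP; rewrite -subr_eq0.
set a := f x in e1 e2 *; set b := f y in e1 e2 *.
set a' := g x in e1 e2 *; set b' := g y in e1 e2 *.
set c := s (p a) in e1 e2 *; set d := s (p b) in e1 e2 *.
have -> : a * b + a' * b' - c * d - (a + a' - c) * (b + b' - d) =
   - ((a' - c) * (b - d)) - ((a - c) * (b' - d)) by ring.
by rewrite e1 e2 subr0 oppr0.
Qed.

HB.instance Definition _ :=
  GRing.isZmodMorphism.Build W Y fiber_add_fun fiber_add_zmod.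
HB.instance Definition _ :=
  GRing.isMonoidMorphism.Build W Y fiber_add_fun fiber_add_monoid.

Definition fiber_add : {rmorphism W -> Y} := fiber_add_fun.
End Add.
End SquareZeroRing.

Section Taylor.
Variable R : realType.
Local Notation E := (euclidean_category R).
Local Notation U := cinf_underlying_map.

Lemma derive_entry n m (f : 'rV[R]_n -> 'rV[R]_m) (v x : 'rV[R]_n) j :
  differentiable f x -> 'D_v (fun x => f x 0 j) x = 'D_v f x 0 j.
Proof.
move=> df; have de : differentiable (entry j) (f x).
  by apply: linear_differentiable; exact: coord_continuous.
rewrite !deriveE//; last exact: (@differentiable_comp _ _ _ _ f (entry j)).
rewrite (@diff_comp _ _ _ _ f (entry j))//= diff_lin//.
exact: coord_continuous.
Qed.

(** The identity of Hadamard's lemma is an equation between smooth functions,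
so it holds in every C^oo-ring. *)
Lemma ev_hadamard n (h : @hom E n 1%N) :
  exists g : 'I_n -> @hom E (n + n)%N 1%N,
    (forall i, g i ∘ eucl_pair (idc (n : E)) (idc (n : E)) =
               eucl_partial h i) /\
    forall (A : cinf_ring_category R) (x y : fobj (sval A) n),
      ev h y - ev h x =
      \sum_i (ev (eucl_coord R i) y - ev (eucl_coord R i) x) *
             ev (g i) (cinf_pair x y).
Proof.
have [g [gs gE g0]] := hadamard (fun k => Ck_val k h).
exists (fun i => scalar_hom (gs i)); split=> [i|A x y].
  apply: eucl_hom1_ext => x; rewrite mxE g0 derive_entry//.
  exact: (svalP h 1%N).1.
pose z := cinf_pair x y.
have diff_smooth n' (k l : @hom E n' 1%N) d :
    Ck d (fun x => sval k x 0 0 - sval l x 0 0).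
  by apply: Ck_add; [|apply: Ck_opp]; exact: Ck_val.
have evs (k : @hom E n 1%N) (l : @hom E n 1%N) :
    ev k y - ev l x =
    ev (scalar_hom (diff_smooth _ (k ∘ eucl_snd R n n)
                                  (l ∘ eucl_fst R n n))) z.
  rewrite (@evB _ _ _ (k ∘ eucl_snd R n n) (l ∘ eucl_fst R n n)).
    by rewrite -!ev_fmap cinf_fst_pair cinf_snd_pair.
  by move=> v; rewrite mxE.
rewrite evs //; under eq_bigr do rewrite evs //.
apply: ev_sumM => v; rewrite mxE /= gE hsubmxK.
by apply: eq_bigr => i _; rewrite !mxE.
Qed.

Variables (X A : cinf_ring_category R) (p : hom X A) (s : hom A X).
Hypothesis ps : square_zero (U p) (U s).

Lemma section_ntapp n (a : fobj (sval A) n) : ntapp p n (ntapp s n a) = a.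
Proof. by apply: cinf_coord_inj => i; rewrite -!ev_nat ps.1. Qed.

(** Apply [ev_hadamard] between [s (p x)] and [x]: the differences of the
coordinates lie in the kernel, so by [square_zeroM] only the value of [g i] at
[(p x, p x)] matters, and that is a partial derivative. *)
Lemma taylor n (h : @hom E n 1%N) (x : fobj (sval X) n) :
  ev h x = U s (ev h (ntapp p n x)) +
    \sum_i (ev (eucl_coord R i) x - U s (U p (ev (eucl_coord R i) x))) *
           U s (ev (eucl_partial h i) (ntapp p n x)).
Proof.
set a := ntapp p n x.
have [g [g0 gE]] := ev_hadamard h.
rewrite ev_nat; apply/eqP; rewrite addrC -subr_eq; apply/eqP; rewrite gE.
apply: eq_bigr => i _; rewrite -!ev_nat (square_zeroM ps); last first.
  by rewrite rmorphB /= !ps.1 subrr.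
congr (_ * U s _); rewrite !ev_nat ntapp_pair section_ntapp -g0 -ev_fmap.
by congr (ev _ _); rewrite -cinf_pair_fmap !fmap_id.
Qed.
End Taylor.

Section Lifting.
Variable R : realType.
Local Notation E := (euclidean_category R).
Local Notation U := cinf_underlying_map.
Variables (X A : cinf_ring_category R) (p : hom X A) (s : hom A X).
Hypothesis ps : square_zero (U p) (U s).
Variables (Z B : cinf_ring_category R) (q : hom Z B) (t : hom B Z).
Hypothesis qt : square_zero (U q) (U t).
Variables (f : hom A B)
  (u : {rmorphism cinf_underlying X -> cinf_underlying Z}).
Hypothesis uq : forall x, U q (u x) = U f (U p x).
Hypothesis ut : forall a, u (U s a) = U t (U f a).

Definition lift_fun n (x : fobj (sval X) n) : fobj (sval Z) n :=
  cinf_tuple (fun i => u (ev (eucl_coord R i) x)).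

Lemma lift_fun_base n (x : fobj (sval X) n) :
  ntapp q n (lift_fun x) = ntapp f n (ntapp p n x).
Proof.
by apply: cinf_coord_inj => i; rewrite -!ev_nat ev_coord_tuple uq.
Qed.

(** Both sides are computed by [taylor], and [f] commutes with the smooth
operations of the base rings. *)
Lemma lift_fun_ev n (h : @hom E n 1%N) (x : fobj (sval X) n) :
  u (ev h x) = ev h (lift_fun x).
Proof.
rewrite (taylor ps) (taylor qt) lift_fun_base rmorphD rmorph_sum ut ev_nat.
congr (_ + _); apply: eq_bigr => i _.
by rewrite rmorphM rmorphB !ut ev_coord_tuple uq -!ev_nat.
Qed.

Lemma lift_fun_natural (n m : E) (h : hom n m) :
  (fun x => lift_fun (fmap (sval X) h x)) =
  (fun x => fmap (sval Z) h (lift_fun x)).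
Proof.
apply/funext => x; apply: cinf_coord_inj => i.
by rewrite ev_coord_tuple !ev_fmap lift_fun_ev.
Qed.

Definition cinf_lift : hom X Z :=
  @NatTrans E set_category (sval X) (sval Z) lift_fun lift_fun_natural.

Lemma cinf_liftE : U cinf_lift = u.
Proof.
apply: rmorphism_ext => x; rewrite -[LHS]ev_coord1 -[in RHS](ev_coord1 x).
exact: esym (lift_fun_ev _ _).
Qed.
End Lifting.

(** * Abelian group objects as square-zero extensions *)

Section TangentPieces.
Variables (C : category) (pb : pullbacks C).
Implicit Types X Y : tangent_obj pb.

Definition tsrc X : C := src (ab_car (tfib X)).
Definition tproj X : hom (tsrc X) (tbase X) := arr (ab_car (tfib X)).
Definition tzero X : hom (tbase X) (tsrc X) := sval (ab_zero (tfib X)).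
Definition tadd X : hom (pb (tproj X) (tproj X)) (tsrc X) :=
  sval (ab_add (tfib X)).

Lemma tproj_zero X : tproj X ∘ tzero X = idc (tbase X).
Proof. exact: svalP (ab_zero (tfib X)). Qed.

Lemma tadd_zerol X : exists i : hom (tsrc X) (pb (tproj X) (tproj X)),
  [/\ pb1 _ ∘ i = tzero X ∘ tproj X, pb2 _ ∘ i = idc _ & tadd X ∘ i = idc _].
Proof.
pose G := tfib X; pose P := slice_products (tbase X) pb.
pose z := ab_zero G ∘ bang (fp_term P) G.
exists (sval (pairc (fp_prod P G G) z (idc (ab_car G)))); split.
- exact: (congr1 sval (pr1_pairc (fp_prod P G G) z (idc _))).
- exact: (congr1 sval (pr2_pairc (fp_prod P G G) z (idc _))).
- exact: (congr1 sval (gadd0 (idc (ab_car G)))).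
Qed.

Lemma tadd_zeror X : exists i : hom (tsrc X) (pb (tproj X) (tproj X)),
  [/\ pb1 _ ∘ i = idc _, pb2 _ ∘ i = tzero X ∘ tproj X & tadd X ∘ i = idc _].
Proof.
pose G := tfib X; pose P := slice_products (tbase X) pb.
pose z := ab_zero G ∘ bang (fp_term P) G.
exists (sval (pairc (fp_prod P G G) (idc (ab_car G)) z)); split.
- exact: (congr1 sval (pr1_pairc (fp_prod P G G) (idc _) z)).
- exact: (congr1 sval (pr2_pairc (fp_prod P G G) (idc _) z)).
- have := gadd0 (idc (ab_car G)); rewrite gaddC => e.
  exact: (congr1 sval e).
Qed.
End TangentPieces.

(** The arguments below use a category only through a functor [U] to commutative
rings with the following three properties; they serve for C^oo-rings and, with
[U] the identity, for commutative rings themselves. *)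
Section RingValuedFunctor.
Variables (C : category) (U : functor C cring_category).

Definition uring (a : C) : comPzRingType := U a.
Definition umap (a b : C) (f : hom a b) : {rmorphism uring a -> uring b} :=
  fmap U f.

Lemma umap_id a x : umap (idc a) x = x.
Proof. by rewrite /umap fmap_id. Qed.

Lemma umap_comp (a b c : C) (g : hom b c) (f : hom a b) x :
  umap (g ∘ f) x = umap g (umap f x).
Proof. by rewrite /umap fmap_comp. Qed.

Definition faithful_on_rings : Prop :=
  forall (a b : C) (f g : hom a b), umap f =1 umap g -> f = g.

Definition pullbacks_jointly_injective (pb : pullbacks C) : Prop :=
  forall (a b c : C) (f : hom a c) (g : hom b c) (w w' : uring (pb a b c f g)),
  umap (pb1 _) w = umap (pb1 _) w' ->
  umap (pb2 _) w = umap (pb2 _) w' -> w = w'.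

(** For commutative rings this is trivial; for C^oo-rings it is where the
first-order formula [taylor] enters. *)
Definition lifts_square_zero : Prop :=
  forall (X A : C) (p : hom X A) (s : hom A X),
  square_zero (umap p) (umap s) ->
  forall (Z B : C) (q : hom Z B) (t : hom B Z),
  square_zero (umap q) (umap t) ->
  forall (f : hom A B) (u : {rmorphism uring X -> uring Z}),
  (forall x, umap q (u x) = umap f (umap p x)) ->
  (forall a, u (umap s a) = umap t (umap f a)) ->
  exists v : hom X Z, umap v =1 u.
End RingValuedFunctor.

Section TangentRing.
Variables (C : category) (pb : pullbacks C) (U : functor C cring_category).
Local Notation uring := (uring U).
Local Notation umap := (@umap C U _ _).

Lemma umap_pb_comm (a b c : C) (f : hom a c) (g : hom b c)
    (w : uring (pb f g)) : umap f (umap (pb1 _) w) = umap g (umap (pb2 _) w).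
Proof. by rewrite -!umap_comp pb_comm. Qed.

Hypothesis U_faithful : faithful_on_rings U.
Hypothesis U_pb : pullbacks_jointly_injective U pb.

Section Object.
Variable X : tangent_obj pb.
Local Notation p := (umap (tproj X)).
Local Notation s := (umap (tzero X)).
Local Notation P := (pb (tproj X) (tproj X)).

Lemma umap_tproj_zero : cancel s p.
Proof. by move=> a; rewrite -umap_comp tproj_zero umap_id. Qed.

Lemma umap_zerol : exists i : {rmorphism uring (tsrc X) -> uring P},
  forall y, [/\ umap (pb1 P) (i y) = s (p y), umap (pb2 P) (i y) = y &
             umap (tadd X) (i y) = y].
Proof.
have [i [i1 i2 ai]] := tadd_zerol X; exists (umap i) => y.
by rewrite -!umap_comp i1 i2 ai !umap_id.
Qed.

Lemma umap_zeror : exists i : {rmorphism uring (tsrc X) -> uring P},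
  forall y, [/\ umap (pb1 P) (i y) = y, umap (pb2 P) (i y) = s (p y) &
             umap (tadd X) (i y) = y].
Proof.
have [i [i1 i2 ai]] := tadd_zeror X; exists (umap i) => y.
by rewrite -!umap_comp i1 i2 ai !umap_id.
Qed.

(** Elements [m], [m'] of the kernel are the sums of the pairs [(0, m)] and
[(m', 0)], whose product in the fibre square vanishes; addition is a ring map. *)
Lemma tangent_square_zero : square_zero p s.
Proof.
split; first exact: umap_tproj_zero.
move=> y y' py py'; have [i iP] := umap_zerol; have [j jP] := umap_zeror.
have [[i1 i2 ai] [j1 j2 aj]] := (iP y, jP y').
rewrite -ai -aj -rmorphM (_ : i y * j y' = 0) ?rmorph0//.
apply: U_pb; rewrite rmorphM rmorph0.
  by rewrite i1 py rmorph0 mul0r.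
by rewrite j2 py' rmorph0 mulr0.
Qed.

(** Since addition is also additive for the ring structure, it suffices to write
[(y, y')] as [(y, s b) + (s b, y') - (s b, s b)] with [b = p y = p y']. *)
Lemma umap_tadd (w : uring P) :
  umap (tadd X) w =
  umap (pb1 P) w + umap (pb2 P) w - s (p (umap (pb1 P) w)).
Proof.
have [i iP] := umap_zerol; have [j jP] := umap_zeror.
set y := umap (pb1 P) w; set y' := umap (pb2 P) w.
have pyy' : p y = p y' := umap_pb_comm w.
have [[[i1 i2 ai] [j1 j2 aj]] [k1 k2 ak]] := (iP y', jP y, iP (s (p y))).
have -> : w = j y + i y' - i (s (p y)).
  apply: U_pb; rewrite rmorphB rmorphD /=.
    by rewrite i1 j1 k1 umap_tproj_zero pyy' addrK.
  by rewrite i2 j2 k2 addrAC subrr add0r.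
by rewrite rmorphB rmorphD /= ai aj ak.
Qed.
End Object.

Section Morphism.
Variables X Y : tangent_obj pb.

Lemma thtotal_tproj (h : tangent_hom X Y) :
  tproj Y ∘ thtotal h = thbase h ∘ tproj X.
Proof. exact: thtotal_comm. Qed.

Section Additive.
Variables (f : hom (tbase X) (tbase Y))
  (u : hom (pushf f (ab_car (tfib X))) (ab_car (tfib Y))).
Local Notation PX := (slice_products (tbase X) pb).
Local Notation PY := (slice_products (tbase Y) pb).
Local Notation PXX := (fp_prod PX (ab_car (tfib X)) (ab_car (tfib X))).
Local Notation PYY := (fp_prod PY (ab_car (tfib Y)) (ab_car (tfib Y))).

Definition square_map : hom (pb (tproj X) (tproj X)) (pb (tproj Y) (tproj Y)) :=
  sval (pairc PYY (u ∘ pushf_map f (pr1 PXX)) (u ∘ pushf_map f (pr2 PXX))).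

Lemma pb1_square_map : pb1 _ ∘ square_map = sval u ∘ pb1 _.
Proof.
exact: (congr1 sval (pr1_pairc PYY (u ∘ pushf_map f (pr1 PXX))
  (u ∘ pushf_map f (pr2 PXX)))).
Qed.

Lemma pb2_square_map : pb2 _ ∘ square_map = sval u ∘ pb2 _.
Proof.
exact: (congr1 sval (pr2_pairc PYY (u ∘ pushf_map f (pr1 PXX))
  (u ∘ pushf_map f (pr2 PXX)))).
Qed.

Lemma additive_overE :
  additive_over u <-> sval u ∘ tadd X = tadd Y ∘ square_map.
Proof. by split=> [/(congr1 sval)|e]; [|exact: slice_hom_ext]. Qed.

Lemma umap_square_map w : umap (tadd Y) (umap square_map w) =
  umap (sval u) (umap (pb1 _) w) + umap (sval u) (umap (pb2 _) w) -
  umap (tzero Y) (umap f (umap (tproj X) (umap (pb1 _) w))).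
Proof.
rewrite umap_tadd -!umap_comp pb1_square_map pb2_square_map !umap_comp.
rewrite -!(umap_comp _ (sval u)) (svalP u : tproj Y ∘ sval u = f ∘ tproj X).
by rewrite !umap_comp.
Qed.
End Additive.

(** Additivity at the pair [(s a, s a)] forces the image of [s a] to be the zero of
its fibre. *)
Lemma thtotal_tzero (h : tangent_hom X Y) :
  thtotal h ∘ tzero X = tzero Y ∘ thbase h.
Proof.
pose u := transpose (sval (thfib h)).
have uadd : additive_over u.
  apply: slice_hom_ext.
  have := thtotal_add h (pr1 (fp_prod (slice_products (tbase X) pb) _ _))
    (pr2 (fp_prod (slice_products (tbase X) pb) _ _)).
  by rewrite gadd_pr.
apply: U_faithful => a.
rewrite (umap_comp (thtotal h)) (umap_comp (tzero Y)).
have [i iP] := umap_zerol X; have [i1 i2 ai] := iP (umap (tzero X) a).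
have e : umap (thtotal h) (umap (tadd X) (i (umap (tzero X) a))) =
    umap (tadd Y) (umap (square_map u) (i (umap (tzero X) a))).
  by rewrite -!umap_comp; congr (umap _ _); exact/additive_overE.
rewrite umap_square_map ai i1 i2 !umap_tproj_zero in e.
apply/esym/eqP; rewrite -subr_eq0 -oppr_eq0 opprB; apply/eqP.
apply: (addrI (umap (thtotal h) (umap (tzero X) a))).
by rewrite addrA addr0; exact: esym e.
Qed.

(** Both additions are given by [umap_tadd], a formula in the ring operations,
the projection and the section. *)
Lemma tangent_hom_of_umap (f : hom (tbase X) (tbase Y))
    (v : hom (tsrc X) (tsrc Y)) :
  tproj Y ∘ v = f ∘ tproj X -> v ∘ tzero X = tzero Y ∘ f ->
  exists h : tangent_hom X Y, thbase h = f /\ thtotal h = v.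
Proof.
move=> vp vz.
pose v' : hom (pushf f (ab_car (tfib X))) (ab_car (tfib Y)) :=
  exist (fun h : hom (tsrc X) (tsrc Y) => tproj Y ∘ h = f ∘ tproj X) v vp.
have v'_add : additive_over v'.
  apply/additive_overE; apply: U_faithful => w.
  rewrite [RHS]umap_comp umap_square_map umap_comp umap_tadd rmorphB rmorphD /=.
  by rewrite -[in RHS](umap_comp (tzero Y)) -vz umap_comp.
by exists (tangent_hom_of v'_add); rewrite thtotal_of.
Qed.
End Morphism.
Hypothesis U_lift : lifts_square_zero U.

Section OfSquareZero.
Variables (A X : C) (p : hom X A) (s : hom A X).
Hypothesis ps : square_zero (umap p) (umap s).
Local Notation PA := (slice_products A pb).
Let G : slice A := SliceObj p.
Local Notation P := (pb p p).
Local Notation q := (p ∘ pb1 P).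

Lemma proj_section : p ∘ s = idc A.
Proof. by apply: U_faithful => a; rewrite umap_comp ps.1 umap_id. Qed.

(** With [q], this makes the fibre square a split square-zero extension as well,
so that the addition, a ring map out of it, can be lifted. *)
Definition square_section : hom A P := pb_lift P (erefl (p ∘ s)).

Lemma square_square_zero : square_zero (umap q) (umap square_section).
Proof.
split=> [a|w w'].
  rewrite -umap_comp -compcA /square_section pb1_lift proj_section.
  exact: umap_id.
rewrite !umap_comp => pw pw'.
apply: U_pb; rewrite rmorphM rmorph0; apply: ps.2 => //.
  by rewrite -umap_pb_comm.
by rewrite -umap_pb_comm.
Qed.

Lemma add_ex : exists v : hom P X,
  umap v =1 fiber_add ps (@umap_pb_comm _ _ _ p p).
Proof.
apply: (U_lift square_square_zero ps (f := idc A)) => [w|a].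
  rewrite umap_id umap_comp /= /fiber_add_fun rmorphB rmorphD ps.1.
  by rewrite -umap_pb_comm addrK.
rewrite umap_id /= /fiber_add_fun -!(umap_comp _ square_section).
by rewrite /square_section pb1_lift pb2_lift ps.1 addrK.
Qed.

Lemma opp_ex : exists v : hom X X,
  umap v =1 fiber_opp ps (umap (idc X)).
Proof.
apply: (U_lift ps ps (f := idc A)) => [w|a].
  rewrite /= /fiber_opp_fun rmorphB rmorphMn /= ps.1 !umap_id.
  by rewrite mulr2n addrK.
by rewrite /= /fiber_opp_fun !umap_id ps.1 mulr2n addrK.
Qed.

Definition sz_zero : hom (fp_term PA) G :=
  exist (fun h : hom A X => p ∘ h = idc A) s proj_section.

Lemma sz_opp_subproof : p ∘ sval (cid opp_ex) = p.
Proof.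
case: cid => v /= vE; apply: U_faithful => x; rewrite umap_comp vE.
by rewrite /= /fiber_opp_fun rmorphB rmorphMn /= ps.1 !umap_id mulr2n addrK.
Qed.

Definition sz_opp : hom G G :=
  exist (fun h : hom X X => p ∘ h = p) (sval (cid opp_ex)) sz_opp_subproof.

Lemma sz_add_subproof : p ∘ sval (cid add_ex) = q.
Proof.
case: cid => v /= vE; apply: U_faithful => x; rewrite !umap_comp vE.
by rewrite /= /fiber_add_fun rmorphB rmorphD ps.1 -umap_pb_comm addrK.
Qed.

Definition sz_add : hom (fp_prod PA G G) G :=
  exist (fun h : hom P X => p ∘ h = q) (sval (cid add_ex)) sz_add_subproof.

Lemma umap_over (T : slice A) (x : hom T G) w :
  umap p (umap (sval x) w) = umap (arr T) w.
Proof. by rewrite -umap_comp (svalP x : p ∘ sval x = arr T). Qed.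

Lemma sz_addE (T : slice A) (k : hom T (fp_prod PA G G)) w :
  umap (sval (sz_add ∘ k)) w =
  umap (sval (pr1 (fp_prod PA G G) ∘ k)) w +
  umap (sval (pr2 (fp_prod PA G G) ∘ k)) w - umap s (umap (arr T) w).
Proof.
rewrite -(umap_over (pr1 (fp_prod PA G G) ∘ k)) !umap_comp /=.
by case: cid => v /= ->.
Qed.

Lemma sz_oppE (T : slice A) (k : hom T G) w :
  umap (sval (sz_opp ∘ k)) w =
  umap s (umap (arr T) w) *+ 2 - umap (sval k) w.
Proof.
rewrite -(umap_over k) !umap_comp /=.
by case: cid => v /= ->; rewrite /fiber_opp_fun /= !umap_id.
Qed.

Lemma sz_zeroE (T : slice A) (k : hom T (fp_term PA)) w :
  umap (sval (sz_zero ∘ k)) w = umap s (umap (arr T) w).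
Proof.
rewrite umap_comp; congr (umap s (umap _ w)).
exact: etrans (esym (comp1c _)) (svalP k).
Qed.

Lemma slice_umap_ext (T : slice A) (x y : hom T G) :
  umap (sval x) =1 umap (sval y) -> x = y.
Proof. by move=> xy; apply: slice_hom_ext; exact: U_faithful. Qed.

Lemma sz_addA :
  sz_add ∘ pairc (fp_prod PA G G) (pr1 (fp_prod PA G (fp_prod PA G G)))
    (sz_add ∘ pr2 (fp_prod PA G (fp_prod PA G G))) =
  sz_add ∘ pairc (fp_prod PA G G)
    (sz_add ∘ pairc (fp_prod PA G G)
       (pr1 (fp_prod PA G (fp_prod PA G G)))
       (pr1 (fp_prod PA G G) ∘ pr2 (fp_prod PA G (fp_prod PA G G))))
    (pr2 (fp_prod PA G G) ∘ pr2 (fp_prod PA G (fp_prod PA G G))).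
Proof.
apply: slice_umap_ext => w.
rewrite !sz_addE !pr1_pairc !pr2_pairc !sz_addE !pr1_pairc !pr2_pairc.
ring.
Qed.

Lemma sz_addC :
  sz_add ∘ pairc (fp_prod PA G G)
    (pr2 (fp_prod PA G G)) (pr1 (fp_prod PA G G)) = sz_add.
Proof.
apply: slice_umap_ext => w; rewrite -[sz_add in RHS]compc1.
by rewrite !sz_addE pr1_pairc pr2_pairc !compc1 (addrC (umap _ _)).
Qed.

Lemma sz_add0 :
  sz_add ∘ pairc (fp_prod PA G G) (sz_zero ∘ bang (fp_term PA) G) (idc G) =
  idc G.
Proof.
apply: slice_umap_ext => w.
rewrite sz_addE pr1_pairc pr2_pairc sz_zeroE.
by rewrite addrAC subrr add0r.
Qed.

Lemma sz_addN :
  sz_add ∘ pairc (fp_prod PA G G) sz_opp (idc G) =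
  sz_zero ∘ bang (fp_term PA) G.
Proof.
apply: slice_umap_ext => w.
rewrite sz_addE pr1_pairc pr2_pairc sz_zeroE -[sz_opp]compc1 sz_oppE.
ring.
Qed.

Definition sz_tangent : tangent_obj pb :=
  TangentObj
    (@AbObj _ PA G sz_zero sz_opp sz_add sz_addA sz_addC sz_add0 sz_addN).
End OfSquareZero.
End TangentRing.

(** * The C^oo-ring of a square-zero extension of rings *)

Section Standard.
Variable R : realType.
Local Notation E := (euclidean_category R).

(** Every terminal object or product cone of the domain is isomorphic to a
standard one. *)
Lemma standard_product_preserving (F : functor E set_category) :
  (exists x : F 0%N, forall y, x = y) ->
  (forall n m (x : F n) (y : F m), exists! z : F (n + m)%N,
     fmap F (eucl_fst R n m) z = x /\ fmap F (eucl_snd R n m) z = y) ->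
  product_preserving F.
Proof.
have FC (n m k : E) (g : hom m k) (f : hom n m) (z : F n) :
    fmap F g (fmap F f z) = fmap F (g ∘ f) z by rewrite fmap_comp.
have F1 (n : E) (z : F n) : fmap F (idc n) z = z by rewrite fmap_id.
move=> F0 FP; split=> [t tt|n m k p1 p2 kP].
  have [f _] := tt 0%N; have [g _] := @eucl_terminal R t.
  have gf : f ∘ g = idc t.
    by have [h [_ hu]] := tt t; rewrite -(hu (f ∘ g)) ?(hu (idc t)).
  have [x xu] := F0; apply/set_terminalP; exists (fmap F f x) => y.
  by rewrite -(F1 _ y) -gf -FC (xu (fmap F g y)).
have [i [[i1 i2] _]] := kP _ (eucl_fst R n m) (eucl_snd R n m).
have ik : i ∘ eucl_pair p1 p2 = idc k.
  have [h [_ hu]] := kP _ p1 p2.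
  rewrite -(hu (idc k)) ?compc1//; symmetry; apply: hu.
  by rewrite !compcA i1 i2 eucl_fst_pair eucl_snd_pair.
apply/set_productP => x y; have [z [[zx zy] zu]] := FP n m x y.
exists (fmap F i z); split; first by rewrite !FC i1 i2.
move=> w [wx wy]; rewrite -[w in RHS]F1 -ik -FC; congr (fmap F i _).
by apply: zu; rewrite !FC eucl_fst_pair eucl_snd_pair.
Qed.
End Standard.

Section Derivations.
Variable R : realType.
Local Notation E := (euclidean_category R).

Lemma partialE n (h : @hom E n 1%N) j x :
  sval (eucl_partial h j) x 0 0 = 'D_(delta_mx 0 j) (fun x => sval h x 0 0) x.
Proof. by rewrite derive_entry//; exact: (svalP h 1%N).1. Qed.

Lemma derivable_val n (h : @hom E n 1%N) (x v : 'rV[R]_n) :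
  derivable (fun x => sval h x 0 0) x v.
Proof. by apply: diff_derivable; exact: (Ck_val 1 h).1. Qed.

Lemma partial_coord n (i j : 'I_n) x :
  sval (eucl_partial (eucl_coord R i) j) x 0 0 = (i == j)%:R.
Proof.
rewrite partialE (_ : (fun x => _) = @entry R n i); last first.
  by apply/funext => y; rewrite /= mxE.
rewrite deriveE; last exact: differentiable_coord.
rewrite (@diff_lin _ _ _ (@entry R n i))//; last exact: coord_continuous.
by rewrite -[LHS]/((delta_mx 0 j : 'rV[R]_n) 0 i) mxE eqxx.
Qed.

Lemma partialB n (h k l : @hom E n 1%N) j x :
  (forall x, sval l x 0 0 = sval h x 0 0 - sval k x 0 0) ->
  sval (eucl_partial l j) x 0 0 =
  sval (eucl_partial h j) x 0 0 - sval (eucl_partial k j) x 0 0.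
Proof.
move=> lE; rewrite !partialE (_ : (fun x => sval l x 0 0) =
  (fun x => sval h x 0 0) - (fun x => sval k x 0 0)); last exact/funext.
by rewrite deriveB//; exact: derivable_val.
Qed.

Lemma partialM n (h k l : @hom E n 1%N) j x :
  (forall x, sval l x 0 0 = sval h x 0 0 * sval k x 0 0) ->
  sval (eucl_partial l j) x 0 0 =
  sval h x 0 0 * sval (eucl_partial k j) x 0 0 +
  sval k x 0 0 * sval (eucl_partial h j) x 0 0.
Proof.
move=> lE; rewrite !partialE (_ : (fun x => sval l x 0 0) =
  (fun x => sval h x 0 0) * (fun x => sval k x 0 0)); last exact/funext.
by rewrite deriveM//; exact: derivable_val.
Qed.

Lemma partial_comp n m (h : @hom E m 1%N) (f : @hom E n m) j x :
  sval (eucl_partial (h ∘ f) j) x 0 0 =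
  \sum_i sval (eucl_partial (eucl_coord R i ∘ f) j) x 0 0 *
         sval (eucl_partial h i ∘ f) x 0 0.
Proof.
have df := (svalP f 1%N).1; have dh := (svalP h 1%N).1.
have dhf y : differentiable (sval (h ∘ f)) y := (svalP (h ∘ f) 1%N).1 y.
have -> : sval (eucl_partial (h ∘ f) j) x =
    'D_('D_(delta_mx 0 j) (sval f) x) (sval h) (sval f x).
  rewrite (deriveE _ (df x)) (deriveE _ (dh _)).
  rewrite -[LHS]/('D_(delta_mx 0 j) (sval (h ∘ f)) x) (deriveE _ (dhf x)).
  by rewrite (@diff_comp _ _ _ _ (sval f) (sval h)).
rewrite derive_coord// summxE; apply: eq_bigr => i _.
rewrite mxE partialE; congr (_ * _); rewrite -derive_entry//.
by congr ('D_ _ _ x); apply/funext => y; rewrite mxE.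
Qed.
End Derivations.

Section Extension.
Variable R : realType.
Local Notation E := (euclidean_category R).
Variables (A : cinf_ring_category R) (Y : comPzRingType).
Variables (p : {rmorphism Y -> cinf_underlying A}).
Variables (s : {rmorphism cinf_underlying A -> Y}).
Hypothesis ps : square_zero p s.

(** The component in [A(R^n)] is determined by the tuple; it is kept so that the
map to [A] is the first projection. *)
Definition ext_obj (n : E) : Type :=
  {x : fobj (sval A) n * ('I_n -> Y) |
    forall i, p (x.2 i) = ev (eucl_coord R i) x.1}.

Lemma ext_obj_ext n (x x' : ext_obj n) :
  (sval x).1 = (sval x').1 ->
  (forall i, (sval x).2 i = (sval x').2 i) -> x = x'.
Proof.
move=> e1 e2; apply: sval_inj; apply: injective_projections => //.
exact/funext.
Qed.

(** The right-hand side of the formula [taylor], with [sval x] in place of an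
element of a C^oo-ring over [A]. *)
Definition jet n (h : @hom E n 1%N) (x : ext_obj n) : Y :=
  s (ev h (sval x).1) +
  \sum_j ((sval x).2 j - s (p ((sval x).2 j))) *
         s (ev (eucl_partial h j) (sval x).1).

Lemma jet_base n (h : @hom E n 1%N) (x : ext_obj n) :
  p (jet h x) = ev h (sval x).1.
Proof.
rewrite /jet rmorphD ps.1 rmorph_sum big1 ?addr0// => j _.
by rewrite rmorphM rmorphB !ps.1 subrr mul0r.
Qed.

Lemma jet_subproof (n m : E) (f : @hom E n m) (x : ext_obj n) (i : 'I_m) :
  p (jet (eucl_coord R i ∘ f) x) =
  ev (eucl_coord R i) (fmap (sval A) f (sval x).1).
Proof. by rewrite jet_base ev_fmap. Qed.

Definition ext_map (n m : E) (f : hom n m) (x : ext_obj n) : ext_obj m :=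
  exist _ (fmap (sval A) f (sval x).1, fun i => jet (eucl_coord R i ∘ f) x)
    (jet_subproof f x).

Lemma jet_coord n (i : 'I_n) (x : ext_obj n) :
  jet (eucl_coord R i) x = (sval x).2 i.
Proof.
rewrite /jet (bigD1 i)//= big1 => [|j ji].
  rewrite (@ev1 _ _ _ (eucl_partial _ i)) ?rmorph1 ?mulr1 ?addr0.
    by rewrite -(svalP x i) addrC subrK.
  by move=> v; rewrite partial_coord eqxx.
rewrite (@ev0 _ _ _ (eucl_partial _ j)) ?rmorph0 ?mulr0// => v.
by rewrite partial_coord eq_sym (negbTE ji).
Qed.

(** The chain rule. *)
Lemma jet_ext_map (n m : E) (h : @hom E m 1%N) (f : @hom E n m)
    (x : ext_obj n) :
  jet h (ext_map f x) = jet (h ∘ f) x.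
Proof.
rewrite {1}/jet [RHS]/jet /= ev_fmap; congr (_ + _).
under eq_bigr => i _ do
  rewrite jet_base {1}/jet [s _ + _]addrC addrK mulr_suml ev_fmap.
rewrite exchange_big /=; apply: eq_bigr => j _.
under eq_bigr => i _ do rewrite -mulrA -rmorphM.
rewrite -mulr_sumr -rmorph_sum; congr (_ * s _).
by symmetry; apply: ev_sumM => v; exact: partial_comp.
Qed.

Lemma ext_map_id (n : E) : ext_map (idc n) = fun x => x.
Proof.
apply/funext => x; apply: ext_obj_ext => [|i] /=; first by rewrite fmap_id.
by rewrite -[RHS]jet_coord; congr (jet _ x); exact: (@compc1 E).
Qed.

Lemma ext_map_comp (n m k : E) (g : hom m k) (f : hom n m) :
  ext_map (g ∘ f) = fun x => ext_map g (ext_map f x).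
Proof.
apply/funext => x; apply: ext_obj_ext => [|i]; first by rewrite /= fmap_comp.
by rewrite [RHS]jet_ext_map; congr (jet _ x); exact: (@compcA E).
Qed.

Definition ext_functor : functor E set_category :=
  @Functor E set_category ext_obj ext_map ext_map_id ext_map_comp.

Lemma ext_pair_subproof n m (x : ext_obj n) (y : ext_obj m) (i : 'I_(n + m)) :
  p (match fintype.split i with
     | inl j => (sval x).2 j
     | inr j => (sval y).2 j
     end) = ev (eucl_coord R i) (cinf_pair (sval x).1 (sval y).1).
Proof.
rewrite ev_coord_pair; case: fintype.split => j; first exact: (svalP x).
exact: (svalP y).
Qed.

Lemma ext_product_preserving : product_preserving ext_functor.
Proof.
apply: standard_product_preserving => [|n m x y].
  have p0 (i : 'I_0) : p ((fun=> 0 : Y) i) = ev (eucl_coord R i) (cinf_pt A).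
    by case: i.
  exists (exist _ (cinf_pt A, fun=> 0) p0) => y; apply: ext_obj_ext => [|[]//].
  exact: cinf_ptP.
exists (exist _ (_, _) (ext_pair_subproof x y)); split.
  split; apply: ext_obj_ext => [|i]; try exact: cinf_fst_pair;
    try exact: cinf_snd_pair.
    rewrite -[LHS]/(jet (eucl_coord R i ∘ eucl_fst R n m) _).
    rewrite -eucl_coord_lshift jet_coord /=.
    by rewrite -[lshift m i]/(unsplit (inl i)) unsplitK.
  rewrite -[LHS]/(jet (eucl_coord R i ∘ eucl_snd R n m) _).
  rewrite -eucl_coord_rshift jet_coord /=.
  by rewrite -[rshift n i]/(unsplit (inr i)) unsplitK.
move=> z [zx zy]; apply: ext_obj_ext => [|i].
  by rewrite -zx -zy; exact: cinf_pair_eta.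
have zl j : (sval x).2 j = (sval z).2 (lshift m j).
  rewrite -zx -[LHS]/(jet (eucl_coord R j ∘ eucl_fst R n m) _).
  by rewrite -eucl_coord_lshift jet_coord.
have zr j : (sval y).2 j = (sval z).2 (rshift n j).
  rewrite -zy -[LHS]/(jet (eucl_coord R j ∘ eucl_snd R n m) _).
  by rewrite -eucl_coord_rshift jet_coord.
by rewrite /= -[in RHS](splitK i); case: (fintype.split i) => j /=.
Qed.

Definition ext_ring : cinf_ring_category R :=
  exist _ ext_functor ext_product_preserving.

Definition ext_proj : hom ext_ring A :=
  @NatTrans E set_category ext_functor (sval A)
    (fun n x => (sval x).1) (fun n m f => erefl).

Lemma ext_section_subproof n (a : fobj (sval A) n) (i : 'I_n) :
  p (s (ev (eucl_coord R i) a)) = ev (eucl_coord R i) a.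
Proof. exact: ps.1. Qed.

Definition ext_section_fun (n : E) (a : fobj (sval A) n) : ext_obj n :=
  exist _ (a, fun i => s (ev (eucl_coord R i) a)) (ext_section_subproof a).

Lemma ext_section_natural (n m : E) (f : hom n m) :
  (fun a => ext_section_fun (fmap (sval A) f a)) =
  (fun a => ext_map f (ext_section_fun a)).
Proof.
apply/funext => a; apply: ext_obj_ext => //= i.
rewrite /jet big1 /= ?addr0 ?ev_fmap// => j _.
by rewrite ps.1 subrr mul0r.
Qed.

Definition ext_section : hom A ext_ring :=
  @NatTrans E set_category (sval A) ext_functor ext_section_fun
    ext_section_natural.

(** On [ext_ring], whose elements over [R^1] are 1-tuples, this is the bijection
with [Y]. *)
Definition ext_value (x : cinf_underlying ext_ring) : Y := (sval x).2 0.

Lemma ext_value_ev n (h : @hom E n 1%N) (x : fobj (sval ext_ring) n) :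
  ext_value (ev h x) = jet h x.
Proof.
rewrite -[LHS]/(jet (eucl_coord R 0 ∘ h) x); congr (jet _ x).
by apply: eucl_hom1_ext => v; rewrite mxE.
Qed.

(** Any two elements are values of smooth functions at a common point, which
brings the ring operations under [ext_value_ev]. *)
Lemma ext_ev2 (x y : cinf_underlying ext_ring) :
  exists (z : fobj (sval ext_ring) (1 + 1)%N) (h k : @hom E (1 + 1)%N 1%N),
    x = ev h z /\ y = ev k z.
Proof.
exists (cinf_pair x y), (eucl_fst R 1 1), (eucl_snd R 1 1).
by rewrite /ev cinf_fst_pair cinf_snd_pair.
Qed.

Lemma ext_value_zmod : zmod_morphism ext_value.
Proof.
move=> x y; have [z [h [k [-> ->]]]] := ext_ev2 x y.
have ls d : Ck d (fun x => sval h x 0 0 - sval k x 0 0).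
  by apply: Ck_add; [|apply: Ck_opp]; exact: Ck_val.
have lE v : sval (scalar_hom ls) v 0 0 = sval h v 0 0 - sval k v 0 0.
  by rewrite mxE.
rewrite -(evB z lE) !ext_value_ev /jet (evB _ lE) rmorphB opprD addrACA.
congr (_ + _); rewrite -sumrB; apply: eq_bigr => j _.
rewrite -mulrBr -rmorphB.
rewrite -(@evB _ _ _ _ _ (eucl_partial (scalar_hom ls) j))// => v.
by rewrite (partialB _ _ lE).
Qed.

(** Leibniz' rule; the product of the two first-order parts vanishes in [Y]. *)
Lemma ext_value_monoid : monoid_morphism ext_value.
Proof.
split.
  pose one := @eucl_cst R 0 1.
  have oneE v : sval one v 0 0 = 1 by rewrite mxE.
  rewrite -(ev1 (cinf_pt ext_ring) oneE) ext_value_ev /jet big_ord0 addr0.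
  by rewrite (ev1 _ oneE) rmorph1.
move=> x y; have [z [h [k [-> ->]]]] := ext_ev2 x y.
have ls d : Ck d (fun x => sval h x 0 0 * sval k x 0 0).
  by apply: Ck_mul; exact: Ck_val.
have lE v : sval (scalar_hom ls) v 0 0 = sval h v 0 0 * sval k v 0 0.
  by rewrite mxE.
rewrite -(evM z lE) !ext_value_ev /jet (evM _ lE) rmorphM.
set a := (sval z).1; set d := fun j => (sval z).2 j - s (p ((sval z).2 j)).
have dE j : (sval z).2 j - s (p ((sval z).2 j)) = d j by [].
have pd j : p (d j) = 0 by rewrite /d rmorphB /= ps.1 subrr.
have psum (f : 'I_(1 + 1) -> Y) : p (\sum_j d j * f j) = 0.
  by rewrite rmorph_sum big1// => j _; rewrite rmorphM pd mul0r.
rewrite !(mulrDl, mulrDr) (ps.2 _ _ (psum _) (psum _)) addr0 -addrA.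
congr (_ + _); rewrite mulr_sumr mulr_suml -big_split /=.
apply: eq_bigr => j _; rewrite dE.
rewrite (_ : ev (eucl_partial (scalar_hom ls) j) a =
  ev h a * ev (eucl_partial k j) a + ev k a * ev (eucl_partial h j) a).
  by rewrite rmorphD !rmorphM; ring.
pose hh (b : bool) := if b then h else k.
pose kk (b : bool) := eucl_partial (if b then k else h) j.
(* The two summands of Leibniz' rule, as a sum of products over booleans. *)
rewrite (@ev_sumM _ _ _ _ [:: true; false] hh kk); last move=> v.
  by rewrite !big_cons big_nil addr0.
by rewrite !big_cons big_nil addr0 (partialM _ _ lE).
Qed.

HB.instance Definition _ :=
  GRing.isZmodMorphism.Build (cinf_underlying ext_ring) Y ext_value
    ext_value_zmod.
HB.instance Definition _ :=
  GRing.isMonoidMorphism.Build (cinf_underlying ext_ring) Y ext_value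
    ext_value_monoid.

Definition ext_iso : {rmorphism cinf_underlying ext_ring -> Y} := ext_value.

Lemma ext_iso_base x : p (ext_iso x) = cinf_underlying_map ext_proj x.
Proof. by rewrite /= /ext_value (svalP x) ev_coord1. Qed.

Lemma ext_iso_section a : ext_iso (cinf_underlying_map ext_section a) = s a.
Proof. by rewrite /= /ext_value /= ev_coord1. Qed.

Lemma ext_iso_inj : injective ext_iso.
Proof.
move=> x y xy; have xy0 : (sval x).2 0 = (sval y).2 0 := xy.
apply: ext_obj_ext => [|i]; last by rewrite ord1.
by rewrite -[LHS]ev_coord1 -[RHS]ev_coord1 -(svalP x) -(svalP y) xy0.
Qed.

Lemma ext_iso_inv_subproof (y : Y) (i : 'I_1) :
  p y = ev (eucl_coord R i) (p y : fobj (sval A) 1%N).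
Proof. by rewrite ord1 ev_coord1. Qed.

Definition ext_iso_inv_fun (y : Y) : cinf_underlying ext_ring :=
  exist _ (p y, fun=> y) (ext_iso_inv_subproof y).

Lemma ext_iso_invK : cancel ext_iso_inv_fun ext_iso.
Proof. by []. Qed.

Lemma ext_isoK : cancel ext_iso ext_iso_inv_fun.
Proof. by move=> x; apply: ext_iso_inj. Qed.

Lemma ext_iso_inv_zmod : zmod_morphism ext_iso_inv_fun.
Proof. exact: can2_zmod_morphism ext_isoK ext_iso_invK. Qed.

Lemma ext_iso_inv_monoid : monoid_morphism ext_iso_inv_fun.
Proof. exact: can2_monoid_morphism ext_isoK ext_iso_invK. Qed.

HB.instance Definition _ :=
  GRing.isZmodMorphism.Build Y (cinf_underlying ext_ring) ext_iso_inv_fun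
    ext_iso_inv_zmod.
HB.instance Definition _ :=
  GRing.isMonoidMorphism.Build Y (cinf_underlying ext_ring) ext_iso_inv_fun
    ext_iso_inv_monoid.

Definition ext_iso_inv : {rmorphism Y -> cinf_underlying ext_ring} :=
  ext_iso_inv_fun.

Lemma ext_square_zero :
  square_zero (cinf_underlying_map ext_proj) (cinf_underlying_map ext_section).
Proof.
split=> [a|x y]; first by [].
rewrite -!ext_iso_base => px py; apply: ext_iso_inj.
by rewrite rmorphM rmorph0; exact: ps.2.
Qed.
End Extension.

(** * The equivalence *)

Section EquivalenceCriterion.
Variables (C D : category) (F : functor C D).
Hypothesis F_faithful : forall (a b : C) (f g : hom a b),
  fmap F f = fmap F g -> f = g.
Hypothesis F_full : forall (a b : C) (g : hom (F a) (F b)),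
  exists f : hom a b, fmap F f = g.
Hypothesis F_surj : forall d : D, exists (a : C) (i : hom (F a) d), is_iso i.

Let inv_obj (d : D) : C := sval (cid (F_surj d)).
Let counit (d : D) : hom (F (inv_obj d)) d :=
  sval (cid (svalP (cid (F_surj d)))).
Let counit_iso (d : D) : is_iso (counit d) :=
  svalP (cid (svalP (cid (F_surj d)))).
Let counit_inv (d : D) : hom d (F (inv_obj d)) := sval (cid (counit_iso d)).

Let counit_invK d : counit_inv d ∘ counit d = idc _.
Proof. by rewrite /counit_inv; case: cid => j []. Qed.

Let counitK d : counit d ∘ counit_inv d = idc _.
Proof. by rewrite /counit_inv; case: cid => j []. Qed.

Let lift_hom (a b : C) (g : hom (F a) (F b)) : hom a b := sval (cid (F_full g)).

Let lift_homK (a b : C) (g : hom (F a) (F b)) : fmap F (lift_hom g) = g.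
Proof. exact: svalP (cid (F_full g)). Qed.

Let inv_map (d d' : D) (f : hom d d') : hom (inv_obj d) (inv_obj d') :=
  lift_hom (counit_inv d' ∘ f ∘ counit d).

Let inv_map_id d : inv_map (idc d) = idc (inv_obj d).
Proof. by apply: F_faithful; rewrite lift_homK fmap_id compc1 counit_invK. Qed.

Let inv_map_comp (d d' d'' : D) (g : hom d' d'') (f : hom d d') :
  inv_map (g ∘ f) = inv_map g ∘ inv_map f.
Proof.
apply: F_faithful; rewrite fmap_comp !lift_homK.
rewrite -!compcA; congr (_ ∘ (_ ∘ _)).
by rewrite !compcA counitK comp1c.
Qed.

Let inv_functor : functor D C := Functor inv_map_id inv_map_comp.

Lemma equivalent_of_fully_faithful : equivalent C D.
Proof.
exists F, inv_functor; split.
  pose unit a : hom (inv_obj (F a)) a := lift_hom (counit (F a)).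
  have unit_natural (a b : C) (f : hom a b) :
      unit b ∘ inv_map (fmap F f) = f ∘ unit a.
    apply: F_faithful; rewrite !fmap_comp !lift_homK.
    by rewrite !compcA counitK comp1c.
  exists (@NatTrans _ _ (functor_comp inv_functor F) (functor_id C)
    unit unit_natural).
  move=> a; exists (lift_hom (counit_inv (F a))).
  by split; apply: F_faithful; rewrite fmap_comp fmap_id !lift_homK
    ?counit_invK ?counitK.
have counit_natural (d d' : D) (f : hom d d') :
    counit d' ∘ fmap F (inv_map f) = f ∘ counit d.
  by rewrite lift_homK !compcA counitK comp1c.
exists (@NatTrans _ _ (functor_comp F inv_functor) (functor_id D)
  counit counit_natural).
by move=> d; exact: counit_iso.
Qed.
End EquivalenceCriterion.

Section CringHypotheses.
Local Notation U := (functor_id cring_category).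

Lemma cring_faithful : faithful_on_rings U.
Proof. by move=> a b f g; exact: rmorphism_ext. Qed.

Lemma cring_jointly_inj : pullbacks_jointly_injective U cring_pullbacks.
Proof.
move=> a b c f g w w' e1 e2.
by apply: val_inj; exact: injective_projections.
Qed.

Lemma cring_lift : lifts_square_zero U.
Proof. by move=> X A p s _ Z B q t _ f u _ _; exists u. Qed.
End CringHypotheses.

Section CinfHypotheses.
Variable R : realType.
Local Notation U := (underlying_ring R).

Lemma cinf_faithful : faithful_on_rings U.
Proof. by move=> a b f g; exact: cinf_hom_ext. Qed.

Lemma cinf_jointly_inj : pullbacks_jointly_injective U (cinf_pullbacks R).
Proof. by move=> a b c f g w w'; exact: cinf_pb_ext. Qed.

Lemma cinf_lift_ex : lifts_square_zero U.
Proof.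
move=> X A p s ps Z B q t qt f u uq ut; exists (cinf_lift ps qt uq ut) => x.
exact: (congr1 (fun k : {rmorphism _ -> _} => k x) (cinf_liftE ps qt uq ut)).
Qed.
End CinfHypotheses.

Section Main.
Variable R : realType.
Local Notation U := (underlying_ring R).
Local Notation T_cinf := (tangent_category (cinf_pullbacks R)).
Local Notation T_cring := (tangent_category cring_pullbacks).
Local Notation PB := (category_pullback U (tangent_proj cring_pullbacks)).

Definition cring_tangent (B Y : comPzRingType) (p : {rmorphism Y -> B})
    (s : {rmorphism B -> Y}) (ps : square_zero p s) : T_cring :=
  @sz_tangent _ cring_pullbacks (functor_id cring_category)
    cring_faithful cring_jointly_inj cring_lift B Y p s ps.

Lemma cring_tangent_hom (X Y : tangent_obj cring_pullbacks)
    (f : {rmorphism tbase X -> tbase Y}) (v : {rmorphism tsrc X -> tsrc Y}) :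
  (forall x, (tproj Y : {rmorphism _ -> _}) (v x) =
             f ((tproj X : {rmorphism _ -> _}) x)) ->
  (forall a, v ((tzero X : {rmorphism _ -> _}) a) =
             (tzero Y : {rmorphism _ -> _}) (f a)) ->
  exists h : tangent_hom X Y, thbase h = f /\ thtotal h = v.
Proof.
move=> vp vz.
by apply: (@tangent_hom_of_umap _ _ (functor_id cring_category)
   cring_faithful cring_jointly_inj); exact: rmorphism_ext.
Qed.

(** Rebuilding the group object from the underlying extension of rings avoids
transporting the group structure along the comparison of the two choices of
pullbacks. *)
Definition forget_fiber (X : tangent_obj (cinf_pullbacks R)) : T_cring :=
  cring_tangent (tangent_square_zero (U := U) (@cinf_jointly_inj R) X).

Definition forget_obj (X : T_cinf) : PB :=
  @SpbObj _ _ _ U (tangent_proj cring_pullbacks) (tbase X) (forget_fiber X)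
    erefl.

Lemma forget_fiber_hom_ex (X Y : T_cinf) (h : hom X Y) :
  exists k : tangent_hom (forget_fiber X) (forget_fiber Y),
    thbase k = umap U (thbase h) /\ thtotal k = umap U (thtotal h).
Proof.
apply: cring_tangent_hom => x.
  change (umap U (tproj Y) (umap U (thtotal h) x) =
          umap U (thbase h) (umap U (tproj X) x)).
  by rewrite -!umap_comp thtotal_tproj.
change (umap U (thtotal h) (umap U (tzero X) x) =
        umap U (tzero Y) (umap U (thbase h) x)).
by rewrite -!umap_comp (thtotal_tzero (@cinf_faithful R) (@cinf_jointly_inj R)).
Qed.

Definition forget_fiber_hom (X Y : T_cinf) (h : hom X Y) :
  tangent_hom (forget_fiber X) (forget_fiber Y) :=
  sval (cid (forget_fiber_hom_ex h)).

Lemma thbase_forget (X Y : T_cinf) (h : hom X Y) :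
  thbase (forget_fiber_hom h) = umap U (thbase h).
Proof. by rewrite /forget_fiber_hom; case: cid => k /= []. Qed.

Lemma thtotal_forget (X Y : T_cinf) (h : hom X Y) :
  thtotal (forget_fiber_hom h) = umap U (thtotal h).
Proof. by rewrite /forget_fiber_hom; case: cid => k /= []. Qed.

Definition forget_map (X Y : T_cinf) (h : hom X Y) :
    hom (forget_obj X) (forget_obj Y) :=
  exist _ (thbase h, forget_fiber_hom h) (esym (thbase_forget h)).

Lemma forget_map_id (X : T_cinf) : forget_map (idc X) = idc (forget_obj X).
Proof.
apply: sval_inj; congr (_, _); apply: tangent_hom_ext.
  by rewrite thbase_forget; exact: underlying_id.
rewrite thtotal_forget [RHS]thtotal_of [X in umap U X]thtotal_of.
exact: underlying_id.
Qed.

Lemma forget_map_comp (X Y Z : T_cinf) (g : hom Y Z) (f : hom X Y) :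
  forget_map (g ∘ f) = forget_map g ∘ forget_map f.
Proof.
apply: sval_inj; congr (_, _); apply: tangent_hom_ext.
  rewrite thbase_forget /= !thbase_forget; exact: underlying_comp.
rewrite thtotal_forget [X in umap U X]thtotal_of [RHS]thtotal_of /=.
by rewrite !thtotal_forget; exact: underlying_comp.
Qed.

Definition forget : functor T_cinf PB := Functor forget_map_id forget_map_comp.

Lemma forget_faithful (X Y : T_cinf) (f g : hom X Y) :
  fmap forget f = fmap forget g -> f = g.
Proof.
move=> /(congr1 sval) [ebase /(congr1 (@thtotal _ _ _ _))].
rewrite !thtotal_forget => etotal; apply: tangent_hom_ext => //.
apply: (@cinf_faithful R) => x.
exact: (congr1 (fun k : {rmorphism _ -> _} => k x) etotal).
Qed.

(** The ring map lifts to C^oo-rings by [cinf_lift], and the lift is additive by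
[tangent_hom_of_umap]. *)
Lemma forget_full (X Y : T_cinf) (g : hom (forget_obj X) (forget_obj Y)) :
  exists f : hom X Y, fmap forget f = g.
Proof.
case: g => -[f t] /= ft; have ftE : umap U f = thbase t := ft.
pose u : {rmorphism uring U (tsrc X) -> uring U (tsrc Y)} := thtotal t.
have uq x : umap U (tproj Y) (u x) = umap U f (umap U (tproj X) x).
  rewrite ftE.
  exact: (congr1 (fun k : {rmorphism _ -> _} => k x) (thtotal_tproj t)).
have ut a : u (umap U (tzero X) a) = umap U (tzero Y) (umap U f a).
  rewrite ftE; exact: (congr1 (fun k : {rmorphism _ -> _} => k a)
    (thtotal_tzero cring_faithful cring_jointly_inj t)).
have [v vu] := cinf_lift_ex (tangent_square_zero (@cinf_jointly_inj R) X)
  (tangent_square_zero (@cinf_jointly_inj R) Y) uq ut.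
have vp : tproj Y ∘ v = f ∘ tproj X.
  by apply: (@cinf_faithful R) => x; rewrite !umap_comp vu uq.
have vz : v ∘ tzero X = tzero Y ∘ f.
  by apply: (@cinf_faithful R) => x; rewrite !umap_comp vu ut.
have [h [hf hv]] :=
  tangent_hom_of_umap (@cinf_faithful R) (@cinf_jointly_inj R) vp vz.
exists h; apply: sval_inj; congr (_, _) => //; apply: tangent_hom_ext.
  by rewrite thbase_forget hf ftE.
by rewrite thtotal_forget hv; exact: rmorphism_ext.
Qed.

Section EssentialImage.
Variables (A : cinf_ring_category R)
  (G : ab_obj (slice_products (cinf_underlying A : cring_category)
                              cring_pullbacks)).

Let Z : tangent_obj cring_pullbacks := TangentObj G.
Let Y : comPzRingType := tsrc Z.
Let p : {rmorphism Y -> cinf_underlying A} := tproj Z.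
Let s : {rmorphism cinf_underlying A -> Y} := tzero Z.

Let ps : square_zero p s.
Proof.
exact: (@tangent_square_zero _ _ (functor_id cring_category)
  cring_jointly_inj Z).
Qed.

Definition ext_tangent : tangent_obj (cinf_pullbacks R) :=
  @sz_tangent _ (cinf_pullbacks R) U
    (@cinf_faithful R) (@cinf_jointly_inj R) (@cinf_lift_ex R) A (ext_ring ps)
    (ext_proj ps) (ext_section ps) (ext_square_zero ps).

Let d : PB := @SpbObj _ _ _ U (tangent_proj cring_pullbacks) A Z erefl.

(** A ring isomorphism compatible with projections and sections is additive in
both directions. *)
Lemma ext_tangent_iso : exists i : hom (forget ext_tangent) d, is_iso i.
Proof.
have [k [kb kt]] : exists k : tangent_hom (forget_fiber ext_tangent) Z,
    thbase k = cring_id (cinf_underlying A) /\ thtotal k = ext_iso ps.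
  apply: cring_tangent_hom => x; first exact: ext_iso_base.
  exact: ext_iso_section.
have [l [lb lt]] : exists l : tangent_hom Z (forget_fiber ext_tangent),
    thbase l = cring_id (cinf_underlying A) /\ thtotal l = ext_iso_inv ps.
  apply: cring_tangent_hom => x.
    by [].
  apply: (@ext_iso_inj _ _ _ _ _ ps).
  change (s x = ext_iso ps (umap U (ext_section ps) x)).
  by rewrite (ext_iso_section ps x).
have kP : umap U (idc A) = thbase k by rewrite kb; exact: underlying_id.
have lP : umap U (idc A) = thbase l by rewrite lb; exact: underlying_id.
exists (exist _ (idc A, k) kP), (exist _ (idc A, l) lP).
split; apply: sval_inj; congr (_, _); rewrite ?comp1c//; apply: tangent_hom_ext.
- by rewrite /= kb lb; exact: rmorphism_ext.
- rewrite thtotal_of [RHS]thtotal_of /= kt lt.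
  by apply: rmorphism_ext => x; exact: ext_isoK.
- by rewrite /= kb lb; exact: rmorphism_ext.
- rewrite thtotal_of [RHS]thtotal_of /= kt lt.
  exact: rmorphism_ext.
Qed.
End EssentialImage.

Lemma forget_surj (d : PB) :
  exists (X : T_cinf) (i : hom (forget X) d), is_iso i.
Proof.
(* The equation between the base rings is eliminated while one side is still a
   variable. *)
suff main A (B : comPzRingType) (e : cinf_underlying A = B)
    (G : ab_obj (slice_products (B : cring_category) cring_pullbacks)) :
    exists (X : T_cinf) (i : hom (forget X)
      (@SpbObj _ _ _ U (tangent_proj cring_pullbacks) A (TangentObj G) e)),
    is_iso i.
  by case: d => A [B G] e; exact: main.
case: B / e G => G; exists (ext_tangent G); exact: ext_tangent_iso.
Qed.

End Main.

Theorem mainTheorem2 (R : realType) :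
  equivalent
    (tangent_category (cinf_pullbacks R))
    (category_pullback (underlying_ring R) (tangent_proj cring_pullbacks)).
Proof.
apply: (@equivalent_of_fully_faithful _ _ (forget R)).
- exact: forget_faithful.
- exact: forget_full.
- exact: forget_surj.
Qed.
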